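(* Let $C,A_1,\ldots,A_m,S,\tilde M$ be real symmetric $n\times n$ matrices, and define $$h(\mathbf u)=\ln\det\Bigl(C-\sum_{p=1}^m u_pA_p\Bigr)+\tilde M\bullet\Bigl(C-\sum_{p=1}^m u_pA_p-S\Bigr)$$ for those $\mathbf u\in\mathbb R^m$ for which $C-\sum_{p=1}^m u_pA_p$ is positive definite. Then, for any such point $\mathbf y$ and any $\mathbf z\in\mathbb R^m$, both the gradient $\nabla h(\mathbf y)$ and the Hessian-vector product $(\nabla^2h(\mathbf y))\mathbf z$ can be computed within the same order of time and of space (that is, up to absolute constant factors) as the following algorithm for evaluating $h(\mathbf y)$: compute the sparse Cholesky factorization $C-\sum_{p=1}^m y_pA_p=LL^T$ with $L$ lower triangular, then return $2\sum_i\ln L_{ii}+\tilde M\bullet(C-\sum_{p=1}^m y_pA_p-S)$.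
   Context: $U\bullet W=\sum_{i,j}U_{ij}W_{ij}$ for symmetric matrices. The aggregate sparsity pattern is $E=\{(i,j):C_{ij}\ne0\text{ or }[A_p]_{ij}\neq0\text{ for some }p\}$. All computations are sparse: only entries in the nonzero patterns of the matrices $C,A_p$ and in $F$ are stored and operated on, where $F$ is the chordal extension of $E$, i.e. the (symmetrized) fill-in pattern of the Cholesky factor of a positive definite matrix with pattern $E$ in the given row/column ordering, assuming no numerical cancellation ($F$ is obtained from the graph of $E$ by processing vertices $i=1,\ldots,n$ in order and, for each $i$, joining all pairs of current neighbours of $i$ with larger index; diagonal positions are always included). $S$ has pattern contained in $F$ and only the entries of $\tilde M$ in $F$ are used. The cost model counts each exact real arithmetic operation, square root and logarithm on stored entries as one unit of time, and each stored number as one unit of space. The evaluation algorithm includes forming $C-\sum_p y_pA_p$ from the nonzero entries of $C,A_1,\ldots,A_m$. *)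

(* Defs.v *)
From HB Require Import structures.
From mathcomp Require Import all_boot all_order all_algebra.
From mathcomp Require Import all_classical all_reals all_analysis.
Set Implicit Arguments.
Unset Strict Implicit.
Unset Printing Implicit Defensive.
Import Order.TTheory GRing.Theory Num.Theory.
Import numFieldNormedType.Exports.
Local Open Scope ring_scope.

(** * The function h and its derivatives *)

Definition symmetric_mx (R : realType) (n : nat) (U : 'M[R]_n) : Prop :=
  U^T = U.

Definition posdef_mx (R : realType) (n : nat) (U : 'M[R]_n) : Prop :=
  symmetric_mx U /\
  forall v : 'rV[R]_n, v != 0 -> 0 < (v *m U *m v^T) 0 0.

Definition inner_mx (R : realType) (n : nat) (U W : 'M[R]_n) : R :=
  \sum_i \sum_j U i j * W i j.

Definition slack (R : realType) (n m : nat) (C : 'M[R]_n)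
    (A : 'I_m -> 'M[R]_n) (u : 'rV[R]_m) : 'M[R]_n :=
  C - \sum_p u 0 p *: A p.

(* [ln] is total, so this is an extension of h to all of R^m.  The set of u
   where [slack C A u] is positive definite is open, so the derivatives at
   such a point do not depend on the values taken outside of it. *)
Definition hfun (R : realType) (n m : nat) (C : 'M[R]_n)
    (A : 'I_m -> 'M[R]_n) (S Mt : 'M[R]_n) (u : 'rV[R]_m) : R :=
  ln (\det (slack C A u)) + inner_mx Mt (slack C A u - S).

Definition basis_vec (R : realType) (m : nat) (p : 'I_m) : 'rV[R]_m :=
  delta_mx 0 p.

Definition partial (R : realType) (m : nat) (f : 'rV[R]_m -> R) (p : 'I_m)
    (u : 'rV[R]_m) : R :=
  'D_(basis_vec R p) f u.

Definition gradient (R : realType) (m : nat) (f : 'rV[R]_m -> R)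
    (u : 'rV[R]_m) : 'cV[R]_m :=
  \col_p partial f p u.

Definition hessian (R : realType) (m : nat) (f : 'rV[R]_m -> R)
    (u : 'rV[R]_m) : 'M[R]_m :=
  \matrix_(p, q) partial (partial f q) p u.

(* The limits defining the entries of the gradient and of the Hessian exist. *)
Definition twice_derivable (R : realType) (m : nat) (f : 'rV[R]_m -> R)
    (u : 'rV[R]_m) : Prop :=
  (forall p, derivable f u (basis_vec R p)) /\
  (forall p q, derivable (partial f q) u (basis_vec R p)).

(** * Straight-line programs over the reals *)

Inductive instr (V : Type) : Type :=
  | IConst of V & int
  | ICopy of V & V
  | IAdd of V & V & V
  | ISub of V & V & V
  | IMul of V & V & V
  | IDiv of V & V & V
  | ISqrt of V & V
  | ILn of V & V.

(* The first argument of an instruction is the destination.  Loading an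
   integer constant and moving a number are not arithmetic operations. *)
Definition instr_time (V : Type) (c : instr V) : nat :=
  match c with
  | IConst _ _ | ICopy _ _ => 0%N
  | IAdd _ _ _ | ISub _ _ _ | IMul _ _ _ | IDiv _ _ _
  | ISqrt _ _ | ILn _ _ => 1%N
  end.

Definition instr_cells (V : Type) (c : instr V) : seq V :=
  match c with
  | IConst d _ => [:: d]
  | ICopy d a | ISqrt d a | ILn d a => [:: d; a]
  | IAdd d a b | ISub d a b | IMul d a b | IDiv d a b => [:: d; a; b]
  end.

Definition write (R : realType) (V : eqType) (s : V -> R) (d : V) (r : R) :
    V -> R :=
  fun c => if c == d then r else s c.

(* [None]: the operation is not defined on its arguments. *)
Definition exec_instr (R : realType) (V : eqType) (s : V -> R) (c : instr V) :
    option (V -> R) :=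
  match c with
  | IConst d k => Some (write s d k%:~R)
  | ICopy d a => Some (write s d (s a))
  | IAdd d a b => Some (write s d (s a + s b))
  | ISub d a b => Some (write s d (s a - s b))
  | IMul d a b => Some (write s d (s a * s b))
  | IDiv d a b => if s b == 0 then None else Some (write s d (s a / s b))
  | ISqrt d a => if 0 <= s a then Some (write s d (Num.sqrt (s a))) else None
  | ILn d a => if 0 < s a then Some (write s d (ln (s a))) else None
  end.

Fixpoint exec (R : realType) (V : eqType) (s : V -> R) (cs : seq (instr V)) :
    option (V -> R) :=
  if cs is c :: cs' then obind (fun s' => exec s' cs') (exec_instr s c) else Some s.

Inductive cell (I O W : Type) : Type :=
  | Input of I
  | Output of O
  | Work of W.
Arguments Input {I O W}.
Arguments Output {I O W}.
Arguments Work {I O W}.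

Definition cell_code (I O W : Type) (c : cell I O W) : I + O + W :=
  match c with
  | Input i => inl (inl i) | Output o => inl (inr o) | Work w => inr w
  end.
Definition cell_decode (I O W : Type) (c : I + O + W) : cell I O W :=
  match c with
  | inl (inl i) => Input i | inl (inr o) => Output o | inr w => Work w
  end.
Lemma cell_codeK (I O W : Type) :
  cancel (@cell_code I O W) (@cell_decode I O W).
Proof. by case. Qed.
HB.instance Definition _ (I O W : finType) :=
  Finite.copy (cell I O W) (can_type (@cell_codeK I O W)).

Record program (I O : finType) : Type := Program {
  work : finType;
  code : seq (instr (cell I O work)) }.

(* Only the inputs in [D] are stored: every other cell initially holds 0. *)
Definition init (R : realType) (I O W : finType) (D : {set I}) (x : I -> R) :
    cell I O W -> R :=
  fun c => if c is Input i then if i \in D then x i else 0 else 0.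

Definition computes (R : realType) (I O : finType) (P : program I O)
    (D : {set I}) (x : I -> R) (f : O -> R) : Prop :=
  exists s : cell I O (work P) -> R,
    exec (init D x) (code P) = Some s /\ forall o, s (Output o) = f o.

Definition time_cost (I O : finType) (P : program I O) : nat :=
  (\sum_(c <- code P) instr_time c)%N.

(* The number of cells holding a stored input or an output, or occurring in an
   instruction. *)
Definition space_cost (I O : finType) (P : program I O) (D : {set I}) : nat :=
  #|[set Input i | i in D] :|: [set Output o | o : O]
    :|: [set c : cell I O (work P) | c \in flatten (map (@instr_cells _) (code P))]|.

(** * Sparsity patterns *)

Record pattern (n m : nat) : Type := Pattern {
  patC : {set 'I_n * 'I_n};
  patA : 'I_m -> {set 'I_n * 'I_n} }.

Definition mx_support (R : realType) (n : nat) (U : 'M[R]_n) :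
    {set 'I_n * 'I_n} :=
  [set ij | U ij.1 ij.2 != 0].

Definition pattern_of (R : realType) (n m : nat) (C : 'M[R]_n)
    (A : 'I_m -> 'M[R]_n) : pattern n m :=
  Pattern (mx_support C) (fun p => mx_support (A p)).

Definition aggregate (n m : nat) (P : pattern n m) : {set 'I_n * 'I_n} :=
  patC P :|: \bigcup_p patA P p.

(* Join all pairs of current neighbours of i with larger index. *)
Definition eliminate (n : nat) (F : {set 'I_n * 'I_n}) (i : 'I_n) :
    {set 'I_n * 'I_n} :=
  F :|: [set jk : 'I_n * 'I_n |
          [&& (i < jk.1)%N, (i < jk.2)%N, (jk.1, i) \in F & (i, jk.2) \in F]].

Definition fill (n : nat) (E : {set 'I_n * 'I_n}) : {set 'I_n * 'I_n} :=
  foldl (@eliminate n) (E :|: [set (i, i) | i : 'I_n]) (enum 'I_n).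

Definition chordal (n m : nat) (P : pattern n m) : {set 'I_n * 'I_n} :=
  fill (aggregate P).

(** * The stored problem data *)

Inductive data (n m : nat) : Type :=
  | DC of 'I_n & 'I_n
  | DA of 'I_m & 'I_n & 'I_n
  | DS of 'I_n & 'I_n
  | DM of 'I_n & 'I_n
  | Dy of 'I_m.
Arguments DC {n m}.
Arguments DA {n m}.
Arguments DS {n m}.
Arguments DM {n m}.
Arguments Dy {n m}.

Definition data_code (n m : nat) (d : data n m) :
    'I_n * 'I_n + 'I_m * 'I_n * 'I_n + 'I_n * 'I_n + 'I_n * 'I_n + 'I_m :=
  match d with
  | DC i j => inl (inl (inl (inl (i, j))))
  | DA p i j => inl (inl (inl (inr (p, i, j))))
  | DS i j => inl (inl (inr (i, j)))
  | DM i j => inl (inr (i, j))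
  | Dy p => inr p
  end.
Definition data_decode (n m : nat)
    (c : 'I_n * 'I_n + 'I_m * 'I_n * 'I_n + 'I_n * 'I_n + 'I_n * 'I_n + 'I_m) :
    data n m :=
  match c with
  | inl (inl (inl (inl (i, j)))) => DC i j
  | inl (inl (inl (inr (p, i, j)))) => DA p i j
  | inl (inl (inr (i, j))) => DS i j
  | inl (inr (i, j)) => DM i j
  | inr p => Dy p
  end.
Lemma data_codeK (n m : nat) : cancel (@data_code n m) (@data_decode n m).
Proof. by case. Qed.
HB.instance Definition _ (n m : nat) :=
  Finite.copy (data n m) (can_type (@data_codeK n m)).

Definition data_val (R : realType) (n m : nat) (C : 'M[R]_n)
    (A : 'I_m -> 'M[R]_n) (S Mt : 'M[R]_n) (y : 'rV[R]_m) (d : data n m) : R :=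
  match d with
  | DC i j => C i j
  | DA p i j => A p i j
  | DS i j => S i j
  | DM i j => Mt i j
  | Dy p => y 0 p
  end.

Definition data_stored (n m : nat) (P : pattern n m) : {set data n m} :=
  [set d | match d with
           | DC i j => (i, j) \in patC P
           | DA p i j => (i, j) \in patA P p
           | DS i j | DM i j => (i, j) \in chordal P
           | Dy _ => true
           end].

(* The same data followed by the entries of a vector z. *)
Definition data2_val (R : realType) (n m : nat) (C : 'M[R]_n)
    (A : 'I_m -> 'M[R]_n) (S Mt : 'M[R]_n) (y z : 'rV[R]_m)
    (d : data n m + 'I_m) : R :=
  match d with inl d' => data_val C A S Mt y d' | inr p => z 0 p end.

Definition data2_stored (n m : nat) (P : pattern n m) :
    {set data n m + 'I_m} :=
  [set d | match d with inl d' => d' \in data_stored P | inr _ => true end].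

(** * Evaluation of h by sparse Cholesky factorization *)

Inductive eval_work (n : nat) : Type :=
  | WX of 'I_n & 'I_n   (* C - sum_p y_p A_p, on F *)
  | WL of 'I_n & 'I_n   (* Cholesky factor, on the lower triangle of F *)
  | Wtmp | Wlog | Winner | Wtwo.
Arguments WX {n}.
Arguments WL {n}.
Arguments Wtmp {n}.
Arguments Wlog {n}.
Arguments Winner {n}.
Arguments Wtwo {n}.

Definition eval_work_code (n : nat) (w : eval_work n) :
    'I_n * 'I_n + 'I_n * 'I_n + 'I_4 :=
  match w with
  | WX i j => inl (inl (i, j))
  | WL i j => inl (inr (i, j))
  | Wtmp => inr (inord 0)
  | Wlog => inr (inord 1)
  | Winner => inr (inord 2)
  | Wtwo => inr (inord 3)
  end.
Definition eval_work_decode (n : nat) (c : 'I_n * 'I_n + 'I_n * 'I_n + 'I_4) :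
    eval_work n :=
  match c with
  | inl (inl (i, j)) => WX i j
  | inl (inr (i, j)) => WL i j
  | inr k => match val k with 0 => Wtmp | 1 => Wlog | 2 => Winner | _ => Wtwo end
  end.
Lemma eval_work_codeK (n : nat) :
  cancel (@eval_work_code n) (@eval_work_decode n).
Proof. by case=> //=; rewrite inordK. Qed.
HB.instance Definition _ (n : nat) :=
  Finite.copy (eval_work n) (can_type (@eval_work_codeK n)).

Section EvalCode.
Context (n m : nat) (P : pattern n m).
Local Notation cellT := (cell (data n m) 'I_1 (eval_work n)).
Local Notation F := (chordal P).
Local Notation inp d := (@Input (data n m) 'I_1 (eval_work n) d).
Local Notation X i j := (@Work (data n m) 'I_1 (eval_work n) (WX i j)).
Local Notation L i j := (@Work (data n m) 'I_1 (eval_work n) (WL i j)).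
Local Notation tmp := (@Work (data n m) 'I_1 (eval_work n) Wtmp).
Local Notation logsum := (@Work (data n m) 'I_1 (eval_work n) Wlog).
Local Notation inner := (@Work (data n m) 'I_1 (eval_work n) Winner).
Local Notation two := (@Work (data n m) 'I_1 (eval_work n) Wtwo).

(* The cells of X outside the pattern of C start at 0. *)
Definition form_code : seq (instr cellT) :=
  [seq ICopy (X ij.1 ij.2) (inp (DC ij.1 ij.2)) | ij <- enum (patC P)] ++
  flatten [seq [:: IMul tmp (inp (Dy p)) (inp (DA p ij.1 ij.2));
                   ISub (X ij.1 ij.2) (X ij.1 ij.2) tmp]
          | p <- enum 'I_m, ij <- enum (patA P p)].

Definition below (k : 'I_n) : seq 'I_n :=
  [seq i : 'I_n <- enum 'I_n | (k < i)%N && ((i, k) \in F)].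

(* Right-looking factorization, in place.  By construction of F, the updated
   position (i, j) belongs to F. *)
Definition cholesky_code : seq (instr cellT) :=
  [seq ICopy (L ij.1 ij.2) (X ij.1 ij.2)
  | ij : 'I_n * 'I_n <- enum F & (ij.2 <= ij.1)%N] ++
  flatten [seq
    ISqrt (L k k) (L k k) ::
    [seq IDiv (L i k) (L i k) (L k k) | i <- below k] ++
    flatten [seq [:: IMul tmp (L i k) (L j k); ISub (L i j) (L i j) tmp]
            | i <- below k, j <- [seq j : 'I_n <- below k | (j <= i)%N]]
  | k <- enum 'I_n].

Definition value_code : seq (instr cellT) :=
  flatten [seq [:: ILn tmp (L i i); IAdd logsum logsum tmp]
          | i <- enum 'I_n] ++
  flatten [seq [:: ISub tmp (X ij.1 ij.2) (inp (DS ij.1 ij.2));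
                   IMul tmp (inp (DM ij.1 ij.2)) tmp;
                   IAdd inner inner tmp]
          | ij <- enum F] ++
  [:: IConst two 2; IMul logsum two logsum;
      IAdd (Output ord0) logsum inner].

Definition eval_program : program (data n m) 'I_1 :=
  Program (form_code ++ cholesky_code ++ value_code).

End EvalCode.

(* Main.v *)
Require Import Defs.
From mathcomp Require Import all_boot all_order all_fingroup all_algebra.
From mathcomp Require Import all_classical all_reals all_analysis.
From mathcomp Require Import ring lra zify.
Set Implicit Arguments.
Unset Strict Implicit.
Unset Printing Implicit Defensive.
Import Order.TTheory GRing.Theory Num.Theory.
Import numFieldNormedType.Exports.
Local Open Scope ring_scope.

(* The p-th entry of the gradient is - (X^-1 + Mt) . A_p with X = C - sum_p y_p A_p,
   so only the entries of X^-1 on the chordal extension F are needed.  From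
   X = L L^T, the matrix X^-1 L is upper triangular with diagonal entries 1 / L_jj.
   Since i, k > j with (i, j), (k, j) in F implies (i, k) in F, this determines
   column j of X^-1 on F from the later columns, for at most three times the cost
   of step j of the factorization.  The Hessian-vector product is the derivative
   of the gradient in the direction z, so it is computed by the gradient program
   in forward mode: each cell gets a second cell for its tangent and each
   operation is replaced by at most four. *)

(** * Running straight-line programs *)

(** The gradient could also be sought by reversing the evaluation program, but the factorization
    works in place and overwrites its intermediate values, and recording all of them would take
    space proportional to the time. Computing the entries of X^-1 on F from L alone needs only one
    further array on F. Forward mode in turn needs more than correctness at y: the gradient program
    must succeed and return the gradient at all points y + t z with t near 0. It depends only on the
    patterns of C and the A_p, so the same instructions run along the whole line; positive
    definiteness is an open condition, so every nearby run has a Cholesky factor behind it; and the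
    guards met during a run must be open conditions too. The tangent of an output is then the
    derivative at 0 of a function that coincides near 0 with a partial derivative of h. *)

Section Exec.
Context (R : realType) (V : eqType).
Implicit Types (s t : V -> R) (c d : V) (cs : seq (instr V)).

(* The square root at 0 is excluded because it is not differentiable there. *)
Definition rexec_instr s (c : instr V) : option (V -> R) :=
  if c is ISqrt d a then
    if 0 < s a then Some (write s d (Num.sqrt (s a))) else None
  else exec_instr s c.

Fixpoint rexec s cs : option (V -> R) :=
  if cs is c :: cs' then obind (rexec^~ cs') (rexec_instr s c) else Some s.

Lemma rexec_instr_exec s (c : instr V) t :
  rexec_instr s c = Some t -> exec_instr s c = Some t.
Proof. by case: c => //= d a; case: ltP => // /ltW ->. Qed.

Lemma rexec_exec s cs t : rexec s cs = Some t -> exec s cs = Some t.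
Proof.
elim: cs s => //= c cs IH s.
case E: (rexec_instr s c) => [s'|] //= /IH.
by rewrite (rexec_instr_exec E).
Qed.

Lemma rexec_cat s cs1 cs2 :
  rexec s (cs1 ++ cs2) = obind (rexec^~ cs2) (rexec s cs1).
Proof. by elim: cs1 s => //= c cs IH s; case: (rexec_instr s c). Qed.

Lemma write_eq s d r : write s d r d = r.
Proof. by rewrite /write eqxx. Qed.

Lemma write_neq s d r c : c != d -> write s d r c = s c.
Proof. by rewrite /write => /negbTE ->. Qed.

Lemma rexec_catP s cs1 cs2 t (Q : (V -> R) -> Prop) :
  rexec s cs1 = Some t ->
  (exists t', rexec t cs2 = Some t' /\ Q t') ->
  exists t', rexec s (cs1 ++ cs2) = Some t' /\ Q t'.
Proof. by move=> E [t' [E' Qt]]; exists t'; rewrite rexec_cat E. Qed.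

(** Loops that accumulate: several iterations may hit the same cell, hence the sum. The body is only
    examined in states that agree with [s0] off the targets, so [g] may refer to [s0]; [tmp] is
    exempt because it holds a leftover. *)
Lemma rexec_loop_sum (T : eqType) (tmp : V) (body : T -> seq (instr V))
    (x : T -> V) (g : T -> R) (l : seq T) s0 :
  (forall q s, q \in l ->
     (forall c, c != tmp -> c \notin [seq x q | q <- l] -> s c = s0 c) ->
     exists s', rexec s (body q) = Some s' /\
       forall c, c != tmp -> s' c = s c + (if c == x q then g q else 0)) ->
  exists s', rexec s0 (flatten [seq body q | q <- l]) = Some s' /\
    forall c, c != tmp -> s' c = s0 c + \sum_(q <- l | x q == c) g q.
Proof.
move=> H.
(* The targets stay those of the full list [l] while the induction runs over the list [l1] already
   executed. *)
suff: forall l1, {subset l1 <= l} ->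
  exists s', rexec s0 (flatten [seq body q | q <- l1]) = Some s' /\
    forall c, c != tmp -> s' c = s0 c + \sum_(q <- l1 | x q == c) g q.
  by move/(_ l); apply.
elim/last_ind => [_|l1 q IH sub].
  by exists s0; split=> // c _; rewrite big_nil addr0.
have [|s1 [E1 H1]] := IH.
  by move=> z zl; apply: sub; rewrite mem_rcons inE zl orbT.
have ql : q \in l by apply: sub; rewrite mem_rcons inE eqxx.
have [|s2 [E2 H2]] := H q s1 ql.
  move=> c ct cl; rewrite H1 // big1_seq ?addr0 // => z /andP[/eqP zc zl].
  case/negP: cl; rewrite -zc; apply: map_f; apply: sub.
  by rewrite mem_rcons inE zl orbT.
exists s2; split.
  by rewrite map_rcons flatten_rcons rexec_cat E1.
move=> c ct; rewrite H2 // H1 // -addrA -cats1 big_cat /=; congr (_ + (_ + _)).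
by rewrite big_cons big_nil eq_sym; case: eqP; rewrite ?addr0.
Qed.

(** No factor is a target, so all products may be taken in the initial state. *)
Lemma rexec_loop_mul_sub (T : eqType) (tmp : V) (a b x : T -> V) (l : seq T) s0 :
  {in l, forall q, [&& x q != tmp, a q != tmp, b q != tmp,
     a q \notin [seq x q | q <- l] & b q \notin [seq x q | q <- l]]} ->
  exists s', rexec s0 (flatten [seq [:: IMul tmp (a q) (b q);
                                       ISub (x q) (x q) tmp] | q <- l]) = Some s' /\
    forall c, c != tmp ->
      s' c = s0 c - \sum_(q <- l | x q == c) s0 (a q) * s0 (b q).
Proof.
move=> H.
have [|s' [E Hs']] := @rexec_loop_sum T tmp
  (fun q => [:: IMul tmp (a q) (b q); ISub (x q) (x q) tmp]) x
  (fun q => - (s0 (a q) * s0 (b q))) l s0.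
  move=> q s ql ss0; have /and5P[xt at_ bt al bl] := H q ql.
  rewrite -(ss0 _ at_ al) -(ss0 _ bt bl).
  eexists; split; first reflexivity.
  move=> c ct; rewrite /write eqxx (negbTE xt) (negbTE ct).
  by case: eqP => [->|_]; rewrite ?addr0.
by exists s'; split=> // c ct; rewrite Hs' // sumrN.
Qed.

(** Loops that write each target once. The clause on [s (x q)] lets an instruction read its own
    target before overwriting it, as in the in-place division of a column. *)
Lemma rexec_loop_write (T : eqType) (f : T -> instr V) (x : T -> V)
    (g : T -> R) (l : seq T) s0 :
  uniq [seq x q | q <- l] ->
  (forall q s, q \in l ->
     (forall c, c \notin [seq x q | q <- l] -> s c = s0 c) ->
     s (x q) = s0 (x q) ->
     rexec_instr s (f q) = Some (write s (x q) (g q))) ->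
  exists s', rexec s0 [seq f q | q <- l] = Some s' /\
    (forall c, c \notin [seq x q | q <- l] -> s' c = s0 c) /\
    (forall q, q \in l -> s' (x q) = g q).
Proof.
move=> uxl H.
suff: forall l1 l2, l = l1 ++ l2 ->
  exists s', rexec s0 [seq f q | q <- l1] = Some s' /\
    (forall c, c \notin [seq x q | q <- l1] -> s' c = s0 c) /\
    (forall q, q \in l1 -> s' (x q) = g q).
  by move/(_ l [::]); rewrite cats0; apply.
elim/last_ind => [|l1 q IH] l2 el; first by exists s0.
have [|s1 [E1 [H1 H1']]] := IH (q :: l2); first by rewrite el cat_rcons.
have ql : q \in l by rewrite el mem_cat mem_rcons inE eqxx.
have xq : x q \notin [seq x q | q <- l1].
  move: uxl; rewrite el cat_rcons map_cat cat_uniq /=.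
  by case/and3P=> _ /norP[].
have Hq : rexec_instr s1 (f q) = Some (write s1 (x q) (g q)).
  apply: H => //; last exact: H1.
  move=> c cl; apply: H1; apply: contra cl.
  by rewrite el cat_rcons map_cat mem_cat => ->.
exists (write s1 (x q) (g q)); split; last split.
- by rewrite map_rcons -cats1 rexec_cat E1 /= Hq.
- move=> c; rewrite map_rcons mem_rcons inE => /norP[cx cl].
  by rewrite write_neq // H1.
- move=> z; rewrite mem_rcons inE => /predU1P[->|zl]; first by rewrite write_eq.
  rewrite write_neq; first exact: H1'.
  by apply: contraNneq xq => <-; apply: map_f.
Qed.

Lemma rexec_loop_ord n (body : 'I_n -> seq (instr V))
    (I : nat -> (V -> R) -> Prop) s0 :
  I 0%N s0 ->
  (forall (k : 'I_n) s, I k s ->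
     exists s', rexec s (body k) = Some s' /\ I k.+1 s') ->
  exists s', rexec s0 (flatten [seq body k | k <- enum 'I_n]) = Some s' /\
    I n s'.
Proof.
move=> I0 H.
suff: forall k, (k <= n)%N -> exists s',
   rexec s0 (flatten [seq body k | k <- take k (enum 'I_n)]) = Some s' /\ I k s'.
  move/(_ n (leqnn n)).
  by rewrite take_oversize // size_enum_ord.
elim=> [_|k IH kn]; first by exists s0; rewrite take0.
have [s1 [E1 H1]] := IH (ltnW kn).
have [s2 [E2 H2]] := H (Ordinal kn) s1 H1.
exists s2; split=> //.
rewrite (take_nth (Ordinal kn)) ?size_enum_ord //.
rewrite map_rcons flatten_rcons rexec_cat E1 /=.
suff -> : nth (Ordinal kn) (enum 'I_n) k = Ordinal kn by [].
by apply: val_inj; rewrite /= nth_enum_ord.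
Qed.

End Exec.

(** * Transport of a run along a renaming of cells *)

Section Rename.
Context (R : realType) (V V' : eqType) (f : V -> V').

Definition map_instr (c : instr V) : instr V' :=
  match c with
  | IConst d k => IConst (f d) k
  | ICopy d a => ICopy (f d) (f a)
  | IAdd d a b => IAdd (f d) (f a) (f b)
  | ISub d a b => ISub (f d) (f a) (f b)
  | IMul d a b => IMul (f d) (f a) (f b)
  | IDiv d a b => IDiv (f d) (f a) (f b)
  | ISqrt d a => ISqrt (f d) (f a)
  | ILn d a => ILn (f d) (f a)
  end.

Lemma time_map_instr (cs : seq (instr V)) :
  (\sum_(c <- map map_instr cs) instr_time c = \sum_(c <- cs) instr_time c)%N.
Proof. by rewrite big_map; apply: eq_bigr => -[]. Qed.

Lemma cells_map_instr (cs : seq (instr V)) :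
  flatten (map (@instr_cells _) (map map_instr cs)) =
  map f (flatten (map (@instr_cells _) cs)).
Proof.
rewrite map_flatten -!map_comp; congr flatten.
by apply: eq_map => -[].
Qed.

Hypothesis fI : injective f.

(** Carries the run of the formation and factorization code over to the larger cell type of the
    gradient program. The last clause shows that the cells outside the image still hold their
    initial value. *)
Lemma rexec_map_instr (cs : seq (instr V)) (s : V -> R) (s' : V' -> R) t :
  (forall c, s' (f c) = s c) -> rexec s cs = Some t ->
  exists t', [/\ rexec s' (map map_instr cs) = Some t',
    (forall c, t' (f c) = t c)
    & forall c', (forall c, c' <> f c) -> t' c' = s' c'].
Proof.
have wE (u : V -> R) (u' : V' -> R) d r c : (forall c, u' (f c) = u c) ->
    write u' (f d) r (f c) = write u d r c.
  by move=> h; rewrite /write (inj_eq fI) h.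
have wE' (u' : V' -> R) d r c' : (forall c, c' <> f c) ->
    write u' (f d) r c' = u' c'.
  by move=> h; rewrite write_neq //; apply/eqP; apply: h.
elim: cs s s' => [|c cs IH] s s' ss' /=.
  by case=> <-; exists s'.
case E: (rexec_instr s c) => [u|] //= Et.
suff [u' [-> Hu1 Hu2]] : exists u', [/\ rexec_instr s' (map_instr c) = Some u',
    (forall c, u' (f c) = u c) & forall c', (forall c, c' <> f c) -> u' c' = s' c'].
  have [t' [Et' H1 H2]] := IH u u' Hu1 Et.
  by exists t'; split=> // c' hc; rewrite H2 // Hu2.
case: c E => [d k|d a|d a b|d a b|d a b|d a b|d a|d a] /=; rewrite ?ss';
  try case: ifP => // _; case=> <-; eexists; (split; first reflexivity);
  move=> *; by [apply: wE|apply: wE'].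
Qed.

End Rename.

(** Turns a double loop into a loop over pairs, the form expected by the loop lemmas. *)
Lemma allpairs_map_pair (S T U : Type) (f : S -> T -> U) (s : seq S)
    (t : S -> seq T) :
  [seq f x y | x <- s, y <- t x] =
  [seq f q.1 q.2 | q <- [seq (x, y) | x <- s, y <- t x]].
Proof. by rewrite map_allpairs. Qed.

Lemma uniq_pairs (S T : eqType) (s : seq S) (t : S -> seq T) :
  uniq s -> (forall x, uniq (t x)) -> uniq [seq (x, y) | x <- s, y <- t x].
Proof.
by move=> us ut; apply: allpairs_uniq_dep => // -[x y] [x' y'] _ _ /= [-> ->].
Qed.

(** Evaluates the sum produced by a loop lemma when at most one iteration hits the given cell. *)
Lemma big_uniq_pred1 (R : nmodType) (T : eqType) (l : seq T) (a : T) (g : T -> R) :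
  uniq l -> \sum_(q <- l | q == a) g q = if a \in l then g a else 0.
Proof.
move=> ul; case: ifPn => al.
  by rewrite -big_filter (@filter_pred1_uniq _ l a) // big_seq1.
by rewrite big1_seq // => q /andP[/eqP -> /negP]; rewrite (negbTE al).
Qed.

(** * Forward differentiation of programs *)

Section Tangent.
Context (R : realType) (V : eqType).

(** Every rule reads the state before the instruction, so a destination may coincide with an
    operand. The quotient rule is written through [s a / s b], the quotient that the forward code
    has at hand. *)
Definition tangent (s ds : V -> R) (c : instr V) : V -> R :=
  match c with
  | IConst d _ => write ds d 0
  | ICopy d a => write ds d (ds a)
  | IAdd d a b => write ds d (ds a + ds b)
  | ISub d a b => write ds d (ds a - ds b)
  | IMul d a b => write ds d (ds a * s b + s a * ds b)
  | IDiv d a b => write ds d ((ds a - s a / s b * ds b) / s b)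
  | ISqrt d a => write ds d (ds a / (2 * Num.sqrt (s a)))
  | ILn d a => write ds d (ds a / s a)
  end.

Lemma is_derive_write (s : R -> V -> R) (ds : V -> R) d (r : R -> R) dr x :
  (forall c, is_derive (0 : R) (1 : R) (s^~ c) (ds c)) ->
  is_derive (0 : R) (1 : R) r dr ->
  is_derive (0 : R) (1 : R) (fun t => write (s t) d (r t) x) (write ds d dr x).
Proof. by move=> hs hr; rewrite /write; case: eqP. Qed.

Lemma is_derive_continuous (f : R -> R) (df : R) :
  is_derive (0 : R) (1 : R) f df -> {for 0, continuous f}.
Proof.
by move=> h; apply: differentiable_continuous; apply/derivable1_diffP; case: h.
Qed.

Lemma is_derive_near_gt0 (f : R -> R) (df : R) :
  is_derive (0 : R) (1 : R) f df -> 0 < f 0 -> \forall t \near (0 : R), 0 < f t.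
Proof.
by move=> /is_derive_continuous cf f0; exact: cvgr_gt cf _ f0.
Qed.

Lemma is_derive_near_neq0 (f : R -> R) (df : R) :
  is_derive (0 : R) (1 : R) f df -> f 0 != 0 -> \forall t \near (0 : R), f t != 0.
Proof.
by move=> /is_derive_continuous cf f0; exact: cvgr_neq0 cf f0.
Qed.

Lemma is_derive_div (f g : R -> R) (df dg : R) :
  is_derive (0 : R) (1 : R) f df -> is_derive (0 : R) (1 : R) g dg -> g 0 != 0 ->
  is_derive (0 : R) (1 : R) (fun t => f t / g t) ((df - f 0 / g 0 * dg) / g 0).
Proof.
move=> hf hg g0.
have hV := is_deriveV g0 hg.
apply: (is_derive_eq (is_deriveM hf hV)); rewrite /GRing.scale /=.
by field.
Qed.

(** The guards [s b != 0] and [0 < s a] are open conditions, so by continuity they persist for [t]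
    near 0. *)
Lemma is_derive_rexec_instr (s : R -> V -> R) (ds : V -> R) c u :
  (forall x, is_derive (0 : R) (1 : R) (s^~ x) (ds x)) ->
  rexec_instr (s 0) c = Some u ->
  exists u_ : R -> V -> R, [/\ u_ 0 = u,
    \forall t \near (0 : R), rexec_instr (s t) c = Some (u_ t)
    & forall x, is_derive (0 : R) (1 : R) (u_^~ x) (tangent (s 0) ds c x)].
Proof.
move=> hs; case: c => [d k|d a|d a b|d a b|d a b|d a b|d a|d a] /=.
- case=> <-; exists (fun t => write (s t) d k%:~R); split=> //.
    exact: filterE.
  by move=> x; apply: is_derive_write => //; exact: is_derive_cst.
- case=> <-; exists (fun t => write (s t) d (s t a)); split=> //.
    exact: filterE.
  by move=> x; apply: is_derive_write.
- case=> <-; exists (fun t => write (s t) d (s t a + s t b)); split=> //.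
    exact: filterE.
  by move=> x; apply: is_derive_write => //; apply: is_deriveD.
- case=> <-; exists (fun t => write (s t) d (s t a - s t b)); split=> //.
    exact: filterE.
  by move=> x; apply: is_derive_write => //; apply: is_deriveB.
- case=> <-; exists (fun t => write (s t) d (s t a * s t b)); split=> //.
    exact: filterE.
  move=> x; apply: is_derive_write => //.
  by apply: (is_derive_eq (is_deriveM (hs a) (hs b))); rewrite /GRing.scale /= addrC mulrC.
- case: eqP => // /eqP b0 [<-].
  exists (fun t => write (s t) d (s t a / s t b)); split=> //.
    by apply: filterS (is_derive_near_neq0 (hs b) b0) => t /negbTE ->.
  by move=> x; apply: is_derive_write => //; apply: is_derive_div.
- case: ltP => // a0 [<-].
  exists (fun t => write (s t) d (Num.sqrt (s t a))); split=> //.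
    by apply: filterS (is_derive_near_gt0 (hs a) a0) => t ->.
  move=> x; apply: is_derive_write => //.
  have h1 := is_derive1_sqrt a0.
  apply: (is_derive_eq (@is_derive1_comp R Num.sqrt (s^~ a) 0 _ _ h1 (hs a))).
  by rewrite mulrC mulr_natl.
- case: ltP => // a0 [<-].
  exists (fun t => write (s t) d (ln (s t a))); split=> //.
    by apply: filterS (is_derive_near_gt0 (hs a) a0) => t ->.
  move=> x; apply: is_derive_write => //.
  have h1 := is_derive1_ln a0.
  apply: (is_derive_eq (@is_derive1_comp R (@ln R) (s^~ a) 0 _ _ h1 (hs a))).
  by rewrite mulrC.
Qed.

End Tangent.

(** * Code that propagates tangents *)

Section Forward.
Context (R : realType) (V V' : eqType) (prim tang : V -> V') (t0 t1 : V').

(** A destination may coincide with an operand, as in the in-place loops. For the nonlinear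
    operations, whatever needs the old operands is therefore computed before [prim d] is
    overwritten, with partial results kept in [t0] and [t1]. *)
Definition forward_instr (c : instr V) : seq (instr V') :=
  match c with
  | IConst d k => [:: IConst (prim d) k; IConst (tang d) 0]
  | ICopy d a => [:: ICopy (prim d) (prim a); ICopy (tang d) (tang a)]
  | IAdd d a b => [:: IAdd (prim d) (prim a) (prim b);
                      IAdd (tang d) (tang a) (tang b)]
  | ISub d a b => [:: ISub (prim d) (prim a) (prim b);
                      ISub (tang d) (tang a) (tang b)]
  | IMul d a b => [:: IMul t0 (tang a) (prim b); IMul t1 (prim a) (tang b);
                      IMul (prim d) (prim a) (prim b); IAdd (tang d) t0 t1]
  | IDiv d a b => [:: IDiv t0 (prim a) (prim b); IMul t1 t0 (tang b);
                      ISub t1 (tang a) t1; IDiv (tang d) t1 (prim b);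
                      ICopy (prim d) t0]
  | ISqrt d a => [:: ISqrt t0 (prim a); IConst t1 2; IMul t1 t1 t0;
                     IDiv (tang d) (tang a) t1; ICopy (prim d) t0]
  | ILn d a => [:: IDiv (tang d) (tang a) (prim a); ILn (prim d) (prim a)]
  end.

Definition forward_code (cs : seq (instr V)) : seq (instr V') :=
  flatten [seq forward_instr c | c <- cs].

(** The bound holds instruction by instruction: the free instructions, constants and copies, become
    pairs of free instructions. *)
Lemma time_forward_code (cs : seq (instr V)) :
  (\sum_(c <- forward_code cs) instr_time c <= 4 * \sum_(c <- cs) instr_time c)%N.
Proof.
rewrite /forward_code big_flatten big_map big_distrr /=.
apply: leq_sum => c _.
by case: c => *; rewrite /= ?(big_cons, big_nil).
Qed.

Lemma cells_forward_code (cs : seq (instr V)) c' :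
  c' \in flatten (map (@instr_cells _) (forward_code cs)) ->
  [\/ c' = t0, c' = t1 | exists2 c,
    c \in flatten (map (@instr_cells _) cs) & c' = prim c \/ c' = tang c].
Proof.
elim: cs => //= c cs IH.
rewrite /forward_code /= map_cat flatten_cat !mem_cat => /orP[H|/IH]; last first.
  case=> [->|->|[d dcs dE]]; [exact: Or31|exact: Or32|].
  by apply: Or33; exists d; rewrite // mem_cat dcs orbT.
suff [->|->|[d dc dE]] : [\/ c' = t0, c' = t1
    | exists2 d, d \in instr_cells c & c' = prim d \/ c' = tang d];
  [exact: Or31|exact: Or32| |].
  by apply: Or33; exists d; rewrite // mem_cat dc.
have K d : d \in instr_cells c -> c' = prim d \/ c' = tang d ->
    [\/ c' = t0, c' = t1
    | exists2 d, d \in instr_cells c & c' = prim d \/ c' = tang d].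
  by move=> dc dE; apply: Or33; exists d.
case: c H K => [d k|d a|d a b|d a b|d a b|d a b|d a|d a] /=; rewrite !inE => H K;
  repeat (case/orP: H => H); move/eqP: H => H;
  by [apply: Or31|apply: Or32|apply: (K d); rewrite ?inE ?eqxx ?orbT; auto
     |apply: (K a); rewrite ?inE ?eqxx ?orbT; auto
     |apply: (K b); rewrite ?inE ?eqxx ?orbT; auto].
Qed.

Hypotheses (pI : injective prim) (tI : injective tang).
Hypotheses (pt : forall c d, prim c != tang d) (t01 : t0 != t1).
Hypotheses (pt0 : forall c, prim c != t0) (pt1 : forall c, prim c != t1).
Hypotheses (tt0 : forall c, tang c != t0) (tt1 : forall c, tang c != t1).

Lemma exec_forward_instr (s ds : V -> R) (s' : V' -> R) c u :
  (forall c, s' (prim c) = s c) -> (forall c, s' (tang c) = ds c) ->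
  rexec_instr s c = Some u ->
  exists u', [/\ exec s' (forward_instr c) = Some u',
    forall c, u' (prim c) = u c & forall x, u' (tang x) = tangent s ds c x].
Proof.
move=> sp st.
have tp c1 c2 : (tang c1 == prim c2) = false by rewrite eq_sym; apply/negbTE.
have ptF c1 c2 : (prim c1 == tang c2) = false by apply/negbTE.
have p0 c1 : (prim c1 == t0) = false by apply/negbTE.
have p1 c1 : (prim c1 == t1) = false by apply/negbTE.
have q0 c1 : (tang c1 == t0) = false by apply/negbTE.
have q1 c1 : (tang c1 == t1) = false by apply/negbTE.
have p0' c1 : (t0 == prim c1) = false by rewrite eq_sym.
have p1' c1 : (t1 == prim c1) = false by rewrite eq_sym.
have q0' c1 : (t0 == tang c1) = false by rewrite eq_sym.
have q1' c1 : (t1 == tang c1) = false by rewrite eq_sym.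
have t01' : (t0 == t1) = false by apply/negbTE.
have t10' : (t1 == t0) = false by rewrite eq_sym.
(* One rewriting list decides every comparison of cells: different kinds of cells are distinct, and
   equal kinds reduce by injectivity to the original cells. *)
have E := (tp, ptF, p0, p1, q0, q1, p0', p1', q0', q1', t01', t10', eqxx,
           inj_eq pI, inj_eq tI, sp, st).
case: c => [d k|d a|d a b|d a b|d a b|d a b|d a|d a] /=.
- by case=> <-; eexists; split=> [|c|c]; first reflexivity; rewrite /write !E.
- by case=> <-; eexists; split=> [|c|c]; first reflexivity; rewrite /write !E.
- by case=> <-; eexists; split=> [|c|c]; first reflexivity; rewrite /write !E.
- by case=> <-; eexists; split=> [|c|c]; first reflexivity; rewrite /write !E.
- by case=> <-; eexists; split=> [|c|c]; first reflexivity; rewrite /write !E.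
- case: eqP => // /eqP /negbTE b0 [<-]; rewrite /write !E b0 /= !E b0 /=.
  by eexists; split=> [|c|c]; first reflexivity; rewrite /= !E.
- case: ltP => // a0 [<-]; rewrite /write !E (ltW a0) /= !E.
  have -> : (2%:~R * Num.sqrt (s a) == 0) = false.
    by apply/negbTE; rewrite mulf_neq0 ?gt_eqF // sqrtr_gt0.
  by eexists; split=> [|c|c]; first reflexivity; rewrite /= !E.
- case: ltP => // a0 [<-]; rewrite /write !E gt_eqF //= !E a0.
  by eexists; split=> [|c|c]; first reflexivity; rewrite /= !E.
Qed.

(** The start is a curve [s] of states and not a point with a direction: after one instruction the
    induction hypothesis applies to the curve of resulting states, whose derivatives stand in the
    tangent cells. *)
Lemma forward_codeP (cs : seq (instr V)) (s : R -> V -> R) ds s' u :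
  (forall x, is_derive (0 : R) (1 : R) (s^~ x) (ds x)) ->
  (forall c, s' (prim c) = s 0 c) -> (forall c, s' (tang c) = ds c) ->
  rexec (s 0) cs = Some u ->
  exists (u_ : R -> V -> R) (u' : V' -> R),
    [/\ \forall t \near (0 : R), rexec (s t) cs = Some (u_ t),
        exec s' (forward_code cs) = Some u'
      & forall x, is_derive (0 : R) (1 : R) (u_^~ x) (u' (tang x))].
Proof.
elim: cs s ds s' => [|c cs IH] s ds s' hs sp st /=.
  move=> _; exists s, s'; split=> //; first exact: filterE.
  by move=> x; rewrite st.
case E: (rexec_instr (s 0) c) => [v|] //= Ecs.
have [v_ [v0 nv dv]] := is_derive_rexec_instr hs E.
have [v' [Ev' vp vt]] := exec_forward_instr sp st E.
have [||u_ [u' [nu Eu' du]]] := IH v_ _ v' dv _ vt.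
- by move=> x; rewrite v0.
- by rewrite v0.
exists u_, u'; split=> //.
  by near=> t; rewrite (near nv t) //= (near nu t).
have -> : forward_code (c :: cs) = forward_instr c ++ forward_code cs by [].
have exec_cat (cs1 cs2 : seq (instr V')) (w : V' -> R) :
    exec w (cs1 ++ cs2) = obind (fun w' => exec w' cs2) (exec w cs1).
  by elim: cs1 w => //= i l IHl w; case: (exec_instr w i).
by rewrite exec_cat Ev'.
Unshelve. all: by end_near.
Qed.

End Forward.

(** * Cholesky factors of positive definite matrices *)

Section Cholesky.
Context (R : realType).

Definition cholesky_factor n (X L : 'M[R]_n) : Prop :=
  [/\ forall i j : 'I_n, (i < j)%N -> L i j = 0,
      forall i, 0 < L i i & L *m L^T = X].

(** Induction on the size, splitting off the first row and column: the Schur complement of the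
    corner entry is again positive definite. *)
Lemma posdef_cholesky n (X : 'M[R]_n) :
  posdef_mx X -> exists L, cholesky_factor X L.
Proof.
elim: n X => [|n IH].
  move=> X _; exists X; split; try by case.
  by apply/matrixP => -[].
suff: forall X : 'M[R]_(1 + n),
  posdef_mx X -> exists L : 'M[R]_(1 + n), cholesky_factor X L by [].
move=> X; rewrite -[X]submxK => -[symX posX].
move: (ulsubmx _) (ursubmx _) (dlsubmx _) (drsubmx _) symX posX.
move=> ul b c D.
rewrite [ul]mx11_scalar; move: (ul 0 0) => a {ul}.
rewrite /symmetric_mx tr_block_mx => /eq_block_mx[_ cTb bTc symD] posX.
have cbT (v : 'rV_n) : (v *m c) 0 0 = (b *m v^T) 0 0.
  by rewrite -cTb -trmx_mul [RHS]mxE.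
have quad (k : R) (v : 'rV_n) :
    (row_mx k%:M v *m block_mx a%:M b c D *m (row_mx k%:M v)^T) 0 0 =
    k * a * k + k * (b *m v^T) 0 0 *+ 2 + (v *m D *m v^T) 0 0.
  rewrite tr_row_mx mul_row_block mul_row_col !mulmxDl tr_scalar_mx.
  rewrite -!scalar_mxM !mul_mx_scalar !mul_scalar_mx -scalemxAl.
  have addE (U W : 'M[R]_1) : (U + W) 0 0 = U 0 0 + W 0 0 by rewrite mxE.
  have scaleE (U : 'M[R]_1) : (k *: U) 0 0 = k * U 0 0 by rewrite mxE.
  rewrite !addE !scaleE cbT mxE eqxx mulr1n; ring.
have a0 : 0 < a.
  have := posX (row_mx 1%:M 0); rewrite quad trmx0 !(mulmx0, mul0mx).
  rewrite [(0 : 'M[R]_1) 0 0]mxE.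
  rewrite mulr0 mul0rn !addr0 mulr1 mul1r; apply.
  apply/eqP => /matrixP/(_ 0 (lshift _ 0)); rewrite row_mxEl !mxE.
  by apply/eqP; rewrite oner_eq0.
have posD : posdef_mx (D - a^-1 *: (c *m b)).
  split=> [|v v0].
    by rewrite /symmetric_mx !linearB !linearZ /= trmx_mul symD cTb bTc.
  (* This first coordinate minimizes the quadratic form for given [v], and the minimum is the
     quadratic form of the Schur complement at [v]. *)
  have := posX (row_mx (- (b *m v^T) 0 0 / a)%:M v).
  rewrite quad mulmxBr mulmxBl -scalemxAr -scalemxAl !mulmxA.
  rewrite [v *m c]mx11_scalar -[_%:M *m b *m v^T]mulmxA mul_scalar_mx cbT.
  move: (b *m v^T) (v *m D *m v^T) => B Q; rewrite !mxE => H.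
  have -> : Q 0 0 - a^-1 * (B 0 0 * B 0 0) =
    - B 0 0 / a * a * (- B 0 0 / a) + - B 0 0 / a * B 0 0 *+ 2 + Q 0 0.
    by field; exact: lt0r_neq0.
  apply: H; apply: contraNneq v0 => /eqP.
  by rewrite -row_mx0 => /eqP/eq_row_mx[_ ->].
have [L [Ltrig Lpos LL]] := IH _ posD.
exists (block_mx (Num.sqrt a)%:M 0 ((Num.sqrt a)^-1 *: c) L).
have s0 : 0 < Num.sqrt a by rewrite sqrtr_gt0.
split.
- move=> i j; case: (split_ordP i) => i' ->; case: (split_ordP j) => j' -> /=.
  + by rewrite !ord1.
  + by rewrite block_mxEur mxE.
  + by rewrite ord1.
  + by rewrite !add1n ltnS block_mxEdr; exact: Ltrig.
- move=> i; case: (split_ordP i) => i' ->.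
  + by rewrite block_mxEul mxE eqxx mulr1n.
  + by rewrite block_mxEdr.
- rewrite tr_block_mx mulmx_block trmx0 !(mulmx0, mul0mx, addr0).
  rewrite tr_scalar_mx -scalar_mxM -expr2 sqr_sqrtr ?ltW // LL.
  rewrite mul_scalar_mx mul_mx_scalar linearZ /= !scalerA divff ?gt_eqF //.
  rewrite !scale1r -scalemxAl -scalemxAr scalerA -invfM -expr2 sqr_sqrtr ?ltW //.
  by rewrite cTb addrC subrK.
Qed.

(** * Determinant and inverse through the Cholesky factor *)

Section Factor.
Context n (X L : 'M[R]_n) (XL : cholesky_factor X L).

Lemma cholesky_factor_entry (i j : 'I_n) : X i j = \sum_k L i k * L j k.
Proof. by case: XL => _ _ <-; rewrite mxE; apply: eq_bigr => k _; rewrite mxE. Qed.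

Lemma cholesky_factor_detL : \det L = \prod_i L i i.
Proof. by case: XL => trig _ _; apply: det_trig; apply/is_trig_mxP. Qed.

Lemma cholesky_factor_detL_gt0 : 0 < \det L.
Proof.
by rewrite cholesky_factor_detL; case: XL => _ pos _; apply: prodr_gt0 => i _.
Qed.

Lemma cholesky_factor_det : \det X = (\prod_i L i i) ^+ 2.
Proof.
by rewrite -cholesky_factor_detL; case: XL => _ _ <-; rewrite det_mulmx det_tr.
Qed.

Lemma cholesky_factor_det_gt0 : 0 < \det X.
Proof.
by rewrite cholesky_factor_det -cholesky_factor_detL exprn_gt0 // cholesky_factor_detL_gt0.
Qed.

Lemma cholesky_factor_ln_det : ln (\det X) = 2 * \sum_i ln (L i i).
Proof.
have [_ pos _] := XL.
have lnprod (s : seq 'I_n) : ln (\prod_(i <- s) L i i) = \sum_(i <- s) ln (L i i).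
  elim: s => [|i s IHs]; first by rewrite !big_nil ln1.
  by rewrite !big_cons lnM ?posrE ?prodr_gt0 // IHs.
rewrite cholesky_factor_det expr2 lnM ?posrE ?prodr_gt0 // lnprod.
by rewrite mulr2n mulrDl mul1r.
Qed.

Lemma cholesky_factor_unit : X \in unitmx.
Proof. by rewrite unitmxE unitfE gt_eqF ?cholesky_factor_det_gt0. Qed.

(* X^-1 L is the inverse of L^T, hence upper triangular: this gives the
   recurrence for the columns of X^-1 in decreasing order. *)
Lemma cholesky_factor_inv_mul_lower (i j : 'I_n) :
  (j < i)%N -> (invmx X *m L) i j = 0.
Proof.
have [trig pos LLT] := XL.
have UL : (invmx X *m L) *m L^T = 1%:M.
  by rewrite -mulmxA LLT mulVmx // cholesky_factor_unit.
move: (invmx X *m L) UL => U UL.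
suff: forall m (j : 'I_n), j = m :> nat -> (j < i)%N -> U i j = 0.
  by move=> H; exact: H.
elim/ltn_ind => m IH {}j jm ji.
(* In entry [(i, j)] of [U *m L^T] the terms [k < j] vanish by induction and the terms [k > j] by
   triangularity of [L], leaving [U i j * L j j = 0]. *)
have := congr1 (fun M : 'M[R]_n => M i j) UL.
rewrite !mxE (negbTE (_ : i != j)); last by apply: contraTneq ji => ->; rewrite ltnn.
rewrite (bigD1 j) //= big1 => [|k kj].
  by rewrite addr0 mxE => /eqP; rewrite mulf_eq0 (gt_eqF (pos j)) orbF => /eqP.
rewrite mxE; case: (ltngtP k j) kj => [kj _|jk _|/val_inj ->]; last by rewrite eqxx.
  by rewrite (IH k _ k erefl (ltn_trans kj ji)) ?mul0r // -jm.
by rewrite trig ?mulr0.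
Qed.

Lemma cholesky_factor_inv_mul_diag (i : 'I_n) : (invmx X *m L) i i = (L i i)^-1.
Proof.
have [trig pos LLT] := XL.
have UL : (invmx X *m L) *m L^T = 1%:M.
  by rewrite -mulmxA LLT mulVmx // cholesky_factor_unit.
have trE k : L^T k i = L i k by rewrite mxE.
have := congr1 (fun M : 'M[R]_n => M i i) UL.
rewrite mxE [RHS]mxE eqxx (bigD1 i) //= big1 => [|k ki].
  rewrite addr0 trE => H; apply: (mulIf (lt0r_neq0 (pos i))).
  by rewrite mulVf ?gt_eqF.
rewrite trE; case: (ltngtP k i) ki => [ki _|ik _|/val_inj ->]; last by rewrite eqxx.
  by rewrite cholesky_factor_inv_mul_lower ?mul0r.
by rewrite trig ?mulr0.
Qed.

End Factor.

(** * Symmetry of the inverse and openness of positive definiteness *)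

Lemma invmx_sym n (X : 'M[R]_n) : symmetric_mx X -> symmetric_mx (invmx X).
Proof. by move=> symX; rewrite /symmetric_mx trmx_inv symX. Qed.

(** The sum of the absolute values of the entries is a crude bound for the operator norm; it
    suffices for a perturbation argument. *)
Lemma quadratic_form_bound n (G : 'M[R]_n) (w : 'rV[R]_n) :
  `|(w *m G *m w^T) 0 0| <= (\sum_i \sum_j `|G i j|) * (w *m w^T) 0 0.
Proof.
set N := (w *m w^T) 0 0.
have NE : N = \sum_k w 0 k ^+ 2.
  by rewrite /N mxE; apply: eq_bigr => k _; rewrite mxE expr2.
have wN i : w 0 i ^+ 2 <= N.
  by rewrite NE (bigD1 i) //= lerDl; apply: sumr_ge0 => k _; exact: sqr_ge0.
have wwN i j : `|w 0 i * w 0 j| <= N.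
  rewrite normrM.
  have := wN i; have := wN j; rewrite -(real_normK (num_real (w 0 i))).
  rewrite -(real_normK (num_real (w 0 j))).
  (* [2 |w_i w_j| <= w_i^2 + w_j^2 <= 2 N]. *)
  by have := sqr_ge0 (`|w 0 i| - `|w 0 j|); nra.
have -> : (w *m G *m w^T) 0 0 = \sum_i \sum_j w 0 j * w 0 i * G j i.
  rewrite mxE; apply: eq_bigr => i _; rewrite !mxE mulr_suml.
  by apply: eq_bigr => j _; rewrite mulrAC.
apply: (le_trans (ler_norm_sum _ _ _)); rewrite exchange_big mulr_suml /=.
apply: ler_sum => i _; rewrite mulr_suml; apply: (le_trans (ler_norm_sum _ _ _)).
by apply: ler_sum => j _; rewrite normrM mulrC ler_wpM2l.
Qed.

Lemma row_sqnorm_gt0 n (w : 'rV[R]_n) : w != 0 -> 0 < (w *m w^T) 0 0.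
Proof.
move=> w0; have [i wi] : exists i, w 0 i != 0.
  apply/existsP; apply: contraNT w0; rewrite negb_exists => /forallP H.
  by apply/eqP/rowP => i; rewrite mxE; have := H i; rewrite negbK => /eqP.
rewrite mxE (bigD1 i) //= mxE -expr2 ltr_wpDr //.
  by apply: sumr_ge0 => k _; rewrite mxE -expr2 sqr_ge0.
by rewrite exprn_even_gt0.
Qed.

(** With [X = L L^T] and [G = L^-1 B L^-T] one has [X + t B = L (1 + t G) L^T], which reduces the
    claim to a perturbation of the identity. *)
Lemma posdef_near n (X B : 'M[R]_n) : posdef_mx X -> symmetric_mx B ->
  \forall t \near (0 : R), posdef_mx (X + t *: B).
Proof.
move=> posX symB; have [L XL] := posdef_cholesky posX.
have [trig pos LLT] := XL.
have uL : L \in unitmx by rewrite unitmxE unitfE gt_eqF ?(cholesky_factor_detL_gt0 XL).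
set G := invmx L *m B *m invmx L^T.
set g := \sum_i \sum_j `|G i j|.
have g0 : 0 <= g by apply: sumr_ge0 => i _; apply: sumr_ge0.
(* [g] may be 0, so the radius is taken as the inverse of [g + 1]. *)
have : \forall t \near (0 : R), `|t| < (g + 1)^-1.
  apply: (@cvgr_lt R R (nbhs (0 : R)) _ (fun t => `|t|) `|0 : R|).
    exact: norm_continuous.
  by rewrite normr0 invr_gt0 ltr_wpDl.
apply: filterS => t tg; split.
  by case: posX => symX _; rewrite /symmetric_mx linearD linearZ /= symX symB.
move=> v v0; set w := v *m L.
have w0 : w != 0 by apply: contraNneq v0 => w0; rewrite -(mulmxK uL v) -/w w0 mul0mx.
have -> : v *m (X + t *: B) *m v^T = w *m w^T + t *: (w *m G *m w^T).
  rewrite mulmxDr mulmxDl -scalemxAr -scalemxAl; congr (_ + _ *: _).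
    by rewrite -LLT /w trmx_mul !mulmxA.
  have -> : w *m G = v *m B *m invmx L^T by rewrite /w /G !mulmxA mulmxK.
  by rewrite /w trmx_mul mulmxA mulmxKV // unitmx_tr.
have addE (U W : 'M[R]_1) : (U + t *: W) 0 0 = U 0 0 + t * W 0 0 by rewrite !mxE.
rewrite addE {addE}.
have N0 : 0 < (w *m w^T) 0 0 by exact: row_sqnorm_gt0.
have := quadratic_form_bound G w; rewrite -/g => H.
have {}tg : `|t| * (g + 1) < 1 by rewrite -ltr_pdivlMr ?mul1r // ltr_wpDl.
set q := (w *m G *m w^T) 0 0 in H *; set N := (w *m w^T) 0 0 in H N0 *.
have : `|t * q| < N.
  rewrite normrM; apply: (le_lt_trans (ler_wpM2l (normr_ge0 _) H)).
  rewrite mulrA gtr_pMl //; apply: le_lt_trans tg.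
  by rewrite ler_wpM2l // lerDl.
by rewrite ltr_norml => /andP[H1 _]; rewrite -ltrBlDl sub0r.
Qed.

End Cholesky.

(** * Chordal extension *)

Section Fill.
Context (n : nat).
Implicit Types (E F : {set 'I_n * 'I_n}) (i j k : 'I_n).

Definition sym_pattern F := forall i j, (i, j) \in F -> (j, i) \in F.

Lemma eliminate_sub F i : F \subset eliminate F i.
Proof. exact: finset.subsetUl. Qed.

Lemma foldl_eliminate_sub (l : seq 'I_n) F : F \subset foldl (@eliminate n) F l.
Proof.
elim: l F => //= i l IH F; exact: fintype.subset_trans (eliminate_sub F i) (IH _).
Qed.

Lemma fill_sub E : E \subset fill E.
Proof.
by apply: fintype.subset_trans (foldl_eliminate_sub _ _); exact: finset.subsetUl.
Qed.

Lemma fill_diag E i : (i, i) \in fill E.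
Proof.
apply: (fintype.subsetP (foldl_eliminate_sub _ _)).
by rewrite inE; apply/orP; right; apply: imset_f.
Qed.

Lemma fill_sym E : sym_pattern E -> sym_pattern (fill E).
Proof.
move=> symE; rewrite /fill.
have : sym_pattern (E :|: [set (i, i) | i : 'I_n]).
  move=> i j; rewrite !inE => /orP[/symE ->//|/imsetP[k _ [-> ->]]].
  by apply/orP; right; apply: imset_f.
elim: (enum _) (_ :|: _) => //= k l IH F symF; apply: IH => i j.
rewrite !inE /= => /orP[/symF -> //|/and4P[ki kj Fik Fkj]].
by rewrite ki kj (symF _ _ Fik) (symF _ _ Fkj) orbT.
Qed.

(* Eliminating a later vertex only adds pairs of vertices that are larger still,
   so the neighbours of i no longer change once i has been eliminated. *)
Lemma foldl_eliminate_closed (l : seq 'I_n) F i j k :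
  sorted (fun a b : 'I_n => (a < b)%N) l -> i \in l -> (i < j)%N -> (i < k)%N ->
  (j, i) \in foldl (@eliminate n) F l -> (i, k) \in foldl (@eliminate n) F l ->
  (j, k) \in foldl (@eliminate n) F l.
Proof.
move=> + + ij ik; elim/last_ind: l => // l h IH sl.
rewrite mem_rcons inE foldl_rcons; set G := foldl _ F l in IH *.
move=> il.
have hi : (i <= h)%N.
  case/predU1P: il => [->//|il]; apply: ltnW.
  move: sl; rewrite -cats1 sorted_pairwise; last by move=> a b c; apply: ltn_trans.
  by rewrite pairwise_cat allrel1r => /and3P[/allP/(_ _ il)].
have old (a b : 'I_n) : (a <= h)%N || (b <= h)%N -> (a, b) \in eliminate G h -> (a, b) \in G.
  rewrite !inE /= => ab /orP[//|/and4P[ha hb _ _]].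
  by move: ab; rewrite leqNgt ha leqNgt hb.
move=> /(old j i) Gji /(old i k) Gik.
have {}Gji := Gji (introT orP (or_intror hi)).
have {}Gik := Gik (introT orP (or_introl hi)).
rewrite inE; apply/orP.
(* Either [i] is the vertex just eliminated, which joins [j] and [k], or it was eliminated earlier
   and the induction hypothesis applies to the pattern before [h]. *)
case/predU1P: il => [ih|il].
  by right; rewrite inE /= -ih ij ik Gji Gik.
left; apply: IH => //; move: sl.
by rewrite -cats1 => /(subseq_sorted _ (prefix_subseq _ _)); apply=> a b c; apply: ltn_trans.
Qed.

(** This is chordality of the fill: the natural order is a perfect elimination ordering. It keeps
    both the factorization and the computation of the inverse inside F. *)
Lemma fill_closed E i j k : (i < j)%N -> (i < k)%N ->
  (j, i) \in fill E -> (i, k) \in fill E -> (j, k) \in fill E.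
Proof.
move=> ij ik; apply: foldl_eliminate_closed => //; last by rewrite mem_enum.
rewrite -(@sorted_map _ _ (@nat_of_ord n) ltn); first by rewrite val_enum_ord iota_ltn_sorted.
Qed.

End Fill.

(** * The evaluation program *)

Section Chordal.
Context (n m : nat) (P : pattern n m).

Lemma patA_chordal p ij : ij \in patA P p -> ij \in chordal P.
Proof.
move=> ijA; apply: (fintype.subsetP (fill_sub _)); rewrite inE; apply/orP; right.
by apply/bigcupP; exists p.
Qed.

Lemma below_uniq k : uniq (below P k).
Proof. by rewrite filter_uniq // enum_uniq. Qed.

Lemma mem_below k i : (i \in below P k) = (k < i)%N && ((i, k) \in chordal P).
Proof. by rewrite mem_filter mem_enum andbT. Qed.

Lemma below_closed k i j : sym_pattern (aggregate P) ->
  i \in below P k -> j \in below P k -> (i, j) \in chordal P.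
Proof.
move=> symE; rewrite !mem_below => /andP[ki ik] /andP[kj jk].
exact: fill_closed ki kj ik (fill_sym symE jk).
Qed.

End Chordal.

Section EvalProgram.
Context (R : realType) (n m : nat) (C : 'M[R]_n) (A : 'I_m -> 'M[R]_n).
Context (S Mt : 'M[R]_n) (y : 'rV[R]_m).
Local Notation P := (pattern_of C A).
Local Notation F := (chordal P).
Local Notation D := (data_stored P).
Local Notation x := (data_val C A S Mt y).
Local Notation V := (cell (data n m) 'I_1 (eval_work n)).
Local Notation inp d := (@Input (data n m) 'I_1 (eval_work n) d).
Local Notation WX' i j := (@Work (data n m) 'I_1 (eval_work n) (WX i j)).
Local Notation WL' i j := (@Work (data n m) 'I_1 (eval_work n) (WL i j)).
Local Notation tmp := (@Work (data n m) 'I_1 (eval_work n) Wtmp).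
Local Notation logsum := (@Work (data n m) 'I_1 (eval_work n) Wlog).
Local Notation inner := (@Work (data n m) 'I_1 (eval_work n) Winner).
Local Notation two := (@Work (data n m) 'I_1 (eval_work n) Wtwo).
Local Notation X := (slack C A y).

Lemma eq_WX i j k l : (WX' i j == WX' k l) = ((i, j) == (k, l)).
Proof. by apply/eqP/eqP => -[-> ->]. Qed.

Lemma eq_WL i j k l : (WL' i j == WL' k l) = ((i, j) == (k, l)).
Proof. by apply/eqP/eqP => -[-> ->]. Qed.

Lemma aggregate_C i j : (i, j) \notin F -> C i j = 0.
Proof.
apply: contraNeq => Cij; apply: (fintype.subsetP (fill_sub _)).
by rewrite !inE Cij.
Qed.

Lemma aggregate_A p i j : (i, j) \notin F -> A p i j = 0.
Proof.
by apply: contraNeq => Aij; apply: (patA_chordal (p := p)); rewrite inE.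
Qed.

Lemma slack_support i j : (i, j) \notin F -> X i j = 0.
Proof.
move=> ij; rewrite !mxE summxE aggregate_C // big1 ?subr0 // => p _.
by rewrite mxE aggregate_A // mulr0.
Qed.

Lemma init_C (O W : finType) i j : init D x (@Input _ O W (DC i j)) = C i j.
Proof. by rewrite /= !inE /=; case: eqP. Qed.

Lemma init_A (O W : finType) p i j : init D x (@Input _ O W (DA p i j)) = A p i j.
Proof. by rewrite /= !inE /=; case: eqP. Qed.

Lemma init_y (O W : finType) p : init D x (@Input _ O W (Dy p)) = y 0 p.
Proof. by rewrite /= inE. Qed.

Lemma init_M (O W : finType) i j : (i, j) \in F -> init D x (@Input _ O W (DM i j)) = Mt i j.
Proof. by rewrite /= inE => ->. Qed.

Lemma form_codeP : exists s, rexec (init D x) (form_code P) = Some s /\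
  forall c, c != tmp ->
    s c = if c is Work (WX i j) then X i j else init D x c.
Proof.
have injX (q q' : 'I_n * 'I_n) : WX' q.1 q.2 = WX' q'.1 q'.2 -> q = q'.
  by case: q q' => a b [c d] [-> ->].
have [||s1 [E1 [H1 H1']]] := @rexec_loop_write R V _
    (fun ij : 'I_n * 'I_n => ICopy (WX' ij.1 ij.2) (inp (DC ij.1 ij.2)))
    (fun ij => WX' ij.1 ij.2) (fun ij => C ij.1 ij.2) (enum (patC P)) (init D x).
- by rewrite map_inj_uniq ?enum_uniq.
- move=> q s ql H _ /=; rewrite H ?init_C //.
  by apply/mapP => -[].
have s1X i j : s1 (WX' i j) = C i j.
  have [ij|ij] := boolP ((i, j) \in enum (patC P)); first exact: (H1' (i, j)).
  rewrite H1; last by apply: contra ij => /mapP[[a b] ab [-> ->]].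
  by move: ij; rewrite mem_enum inE negbK => /eqP /= ->.
have s1o c : (forall i j, c <> WX' i j) -> s1 c = init D x c.
  by move=> h; apply: H1; apply/mapP => -[[a b] _ /h].
rewrite /form_code; apply: (rexec_catP E1).
rewrite allpairs_map_pair.
have [|s2 [E2 H2]] := @rexec_loop_mul_sub R V _ tmp
   (fun q : 'I_m * ('I_n * 'I_n) => inp (Dy q.1))
   (fun q => inp (DA q.1 q.2.1 q.2.2)) (fun q => WX' q.2.1 q.2.2)
   [seq (p, ij) | p <- enum 'I_m, ij <- enum (patA P p)] s1.
  by move=> q _; apply/and5P; split=> //; apply/mapP => -[].
exists s2; split; first exact: E2.
move=> c ct; rewrite H2 //.
case: c ct => [d|o|w] ct; try by rewrite s1o // big1_seq ?subr0 // => q /andP[].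
case: w ct => [i j|i j| | | | ] ct //; try by rewrite s1o // big1_seq ?subr0 // => q /andP[].
rewrite s1X [RHS]mxE [X in _ = _ + X]mxE summxE; congr (_ - _).
rewrite big_mkcond big_allpairs_dep /= big_enum /=; apply: eq_bigr => p _.
rewrite mxE -big_mkcond /=.
under eq_bigr do rewrite !s1o // init_y init_A.
under eq_bigl do rewrite eq_WX -surjective_pairing.
(* Each [A p] touches position [(i, j)] at most once; off its pattern the missing term is
   [y 0 p * 0]. *)
rewrite (big_uniq_pred1 (i, j) (fun q => y 0 p * A p q.1 q.2)) ?enum_uniq //.
by rewrite mem_enum inE /=; case: eqP => //= ->; rewrite mulr0.
Qed.

Hypothesis symC : symmetric_mx C.
Hypothesis symA : forall p, symmetric_mx (A p).

Lemma aggregate_sym : sym_pattern (aggregate P).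
Proof.
move=> i j; rewrite !inE => /orP[|/bigcupP[p _]].
  by rewrite -{1}symC mxE => ->.
rewrite inE -{1}symA mxE => Ap; apply/orP; right.
by apply/bigcupP; exists p => //; rewrite inE.
Qed.

Lemma chordal_sym : sym_pattern F.
Proof. exact: fill_sym aggregate_sym. Qed.

Lemma slack_sym : symmetric_mx X.
Proof.
rewrite /symmetric_mx linearB linear_sum /= symC; congr (_ - _).
by apply: eq_bigr => p _; rewrite linearZ /= symA.
Qed.

Context (L : 'M[R]_n) (XL : cholesky_factor X L).

(** For [k <= i], the product [L i k * L k k] equals [X i k] minus the sum of [L i h * L k h] over
    [h < k]. A nonzero contribution puts [(i, k)] into F, either through the support of X or through
    chordality at [h]; strong induction on the column places [(i, h)] and [(k, h)] in F. *)
Lemma factor_support i k : (i, k) \notin F -> L i k = 0.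
Proof.
have [trig pos _] := XL.
suff: forall m (k : 'I_n), k = m :> nat -> forall i, (i, k) \notin F -> L i k = 0.
  by move=> H; exact: H.
elim/ltn_ind => l IH {}k kl {}i ik.
have [ik'|ki] := ltnP i k; first exact: trig.
have := cholesky_factor_entry XL i k; rewrite slack_support //.
rewrite (bigD1 k) //= big1 => [|h hk].
  by rewrite addr0 => /esym/eqP; rewrite mulf_eq0 (gt_eqF (pos k)) orbF => /eqP.
case: (ltngtP h k) hk => [hk _|kh _|/val_inj ->]; last by rewrite eqxx.
  have [Lih|/(IH h _ h erefl) ->] := boolP ((i, h) \in F); rewrite -?kl ?mul0r //.
  have [Lkh|/(IH h _ h erefl) ->] := boolP ((k, h) \in F); rewrite -?kl ?mulr0 //.
  case/negP: ik; exact: fill_closed (leq_trans hk ki) hk Lih (chordal_sym Lkh).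
by rewrite (trig k h) ?mulr0.
Qed.

(** The Schur complement left after [k] elimination steps: X minus the first [k] rank-one terms of
    [L L^T], expressed through the remaining terms. *)
Let schur (k : nat) (i j : 'I_n) := \sum_(l : 'I_n | (k <= l)%N) L i l * L j l.

Let schur_pivot (i k : 'I_n) : schur k i k = L i k * L k k.
Proof.
have [trig pos _] := XL.
rewrite /schur (bigD1 k) //= big1 ?addr0 // => l /andP[kl lk].
by rewrite (trig k l) ?mulr0 // ltn_neqAle kl andbT eq_sym.
Qed.

Let schurS (k i j : 'I_n) : schur k i j = L i k * L j k + schur k.+1 i j.
Proof.
rewrite /schur (bigD1 k) //=; congr (_ + _).
by apply: eq_bigl => l; rewrite andbC ltn_neqAle eq_sym.
Qed.

Let chol_state (s0 : V -> R) (k : nat) (s : V -> R) : Prop :=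
  (forall c, c != tmp -> (forall i j, c <> WL' i j) -> s c = s0 c) /\
  forall i j : 'I_n, (i, j) \in F -> (j <= i)%N ->
    s (WL' i j) = if (j < k)%N then L i j else schur k i j.

(** The factor [L] is fixed beforehand. The run reproduces it because the pivot column of each Schur
    complement is [L i k * L k k], which the square root and the divisions turn into [L i k]. *)
Lemma cholesky_codeP (s0 : V -> R) :
  (forall i j, (i, j) \in F -> s0 (WX' i j) = X i j) ->
  exists s, rexec s0 (cholesky_code P) = Some s /\
    (forall c, c != tmp -> (forall i j, c <> WL' i j) -> s c = s0 c) /\
    forall i j : 'I_n, (i, j) \in F -> (j <= i)%N -> s (WL' i j) = L i j.
Proof.
move=> s0X.
have [trig pos _] := XL.
have injL (q q' : 'I_n * 'I_n) : WL' q.1 q.2 = WL' q'.1 q'.2 -> q = q'.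
  by case: q q' => a b [c d] [-> ->].
have [||s1 [E1 [H1 H1']]] := @rexec_loop_write R V _
    (fun ij : 'I_n * 'I_n => ICopy (WL' ij.1 ij.2) (WX' ij.1 ij.2))
    (fun ij => WL' ij.1 ij.2) (fun ij => X ij.1 ij.2)
    [seq ij : 'I_n * 'I_n <- enum F | (ij.2 <= ij.1)%N] s0.
- by rewrite map_inj_uniq //; exact/filter_uniq/enum_uniq.
- move=> [i j] s; rewrite mem_filter mem_enum => /andP[_ ij] H _ /=.
  by rewrite H ?s0X //; apply/mapP => -[].
rewrite /cholesky_code; apply: (rexec_catP E1).
suff [s [Es [Hs Hs']]] : exists s, rexec s1 (flatten [seq
    ISqrt (WL' k k) (WL' k k) ::
    [seq IDiv (WL' i k) (WL' i k) (WL' k k) | i <- below P k] ++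
    flatten [seq [:: IMul tmp (WL' i k) (WL' j k); ISub (WL' i j) (WL' i j) tmp]
            | i <- below P k, j <- [seq j : 'I_n <- below P k | (j <= i)%N]]
  | k <- enum 'I_n]) = Some s /\ chol_state s0 n s.
  exists s; split=> //; split=> // i j ij ji.
  by rewrite Hs' // ltn_ord.
apply: rexec_loop_ord.
  split=> [c ct cL|i j ij ji].
    by apply: H1; apply/mapP => -[[a b] _ /cL].
  rewrite ltn0 (H1' (i, j)) /=; last by rewrite mem_filter mem_enum /= ji.
  by rewrite (cholesky_factor_entry XL) /schur; apply: eq_bigl.
move=> k s [Hs Hs'].
have skk : s (WL' k k) = L k k ^+ 2.
  by rewrite Hs' ?fill_diag // ltnn schur_pivot expr2.
pose s2 := write s (WL' k k) (L k k).
have E2 : rexec s [:: ISqrt (WL' k k) (WL' k k)] = Some s2.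
  by rewrite /= skk exprn_gt0 //= sqrtr_sqr gtr0_norm.
rewrite -cat1s; apply: (rexec_catP E2).
have [||s3 [E3 [H3 H3']]] := @rexec_loop_write R V _
    (fun i => IDiv (WL' i k) (WL' i k) (WL' k k))
    (fun i => WL' i k) (fun i => L i k) (below P k) s2.
- by rewrite map_inj_uniq ?below_uniq // => i i' [].
- move=> i u; rewrite mem_below => /andP[ki ik] Hu Hui /=.
  rewrite Hui Hu; last first.
    by apply/mapP => -[j]; rewrite mem_below => /andP[kj _] [] E; rewrite E ltnn in kj.
  rewrite /s2 /write eq_WL eqxx eq_WL xpair_eqE eqxx andbT.
  rewrite -val_eqE /= gtn_eqF // gt_eqF //.
  by rewrite Hs' // ?ltnn ?schur_pivot ?mulfK ?gt_eqF // ltnW.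
apply: (rexec_catP E3).
rewrite allpairs_map_pair.
set prs := [seq (i, j) | i <- _, j <- _].
have prsE (i j : 'I_n) : ((i, j) \in prs) = [&& i \in below P k, j \in below P k & (j <= i)%N].
  rewrite /prs; apply/allpairsPdep/idP => [[a [b [Ha Hb [-> ->]]]]|/and3P[Hi Hj ji]].
    by move: Hb; rewrite mem_filter Ha => /andP[-> ->].
  by exists i, j; split=> //; rewrite mem_filter ji.
(* The factors are read in column [k] and the targets lie in later columns, so the update loop does
   not disturb itself. *)
have [|s4 [E4 H4]] := @rexec_loop_mul_sub R V _ tmp
   (fun q : 'I_n * 'I_n => WL' q.1 k) (fun q => WL' q.2 k)
   (fun q => WL' q.1 q.2) prs s3.
  move=> [i j] _; apply/and5P; split=> //; apply/mapP => -[[a b]];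
    rewrite prsE => /and3P[_ + _] [_ E]; rewrite mem_below => /andP[kb _];
    by rewrite E ltnn in kb.
exists s4; split; first exact: E4.
split=> [c ct cL|i j ij ji].
  rewrite H4 // H3; last by apply/mapP => -[i _ /cL].
  rewrite /s2 write_neq; last by apply/eqP => /cL.
  by rewrite Hs // big1_seq ?subr0 // => q /andP[/eqP qc]; case: (cL q.1 q.2).
have prs_uniq : uniq prs by apply: uniq_pairs => [|i0]; [|apply: filter_uniq]; exact: below_uniq.
rewrite H4 //.
under eq_bigl do rewrite eq_WL -surjective_pairing.
rewrite (big_uniq_pred1 (i, j) (fun q => s3 (WL' q.1 k) * s3 (WL' q.2 k))) //.
rewrite prsE ji andbT /=.
have s3L a : a \in below P k -> s3 (WL' a k) = L a k by move=> /H3'.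
have s3o : (j != k) -> s3 (WL' i j) = s (WL' i j).
  move=> jk; rewrite H3.
    by rewrite /s2 write_neq // eq_WL xpair_eqE (negbTE jk) andbF.
  by apply/mapP => -[a _ [_ /eqP]]; rewrite (negbTE jk).
(* Columns before [k] are final, later columns receive the rank-one update, and column [k] has just
   been scaled. *)
have [jk|kj|jk] := ltngtP j k.
- have -> : (j < k.+1)%N by rewrite ltnS ltnW.
  rewrite s3o -?val_eqE /= ?ltn_eqF // Hs' // jk.
  by rewrite !mem_below (ltnNge k j) (ltnW jk) /= andbF subr0.
- rewrite ltnS leqNgt kj /= s3o -?val_eqE /= ?gtn_eqF // Hs' //.
  rewrite ltnNge ltnW //= schurS.
  case: ifPn => [/andP[ib jb]|nb].
    by rewrite !s3L // addrAC subrr add0r.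
  (* The code skips this pair, rightly so: one of the two factors lies outside F and vanishes. *)
  suff -> : L i k * L j k = 0 by rewrite add0r subr0.
  apply/eqP; rewrite mulf_eq0; apply: contraR nb.
  have ki : (k < i)%N by exact: leq_trans kj ji.
  rewrite negb_or !mem_below ki kj /= => /andP[Li Lj].
  by apply/andP; split; [move: Li|move: Lj]; apply: contraR => /factor_support ->.
- have {}jk : j = k by exact: val_inj.
  rewrite jk ltnSn [k \in _]mem_below ltnn /= andbF subr0.
  have [ik|ik] := eqVneq i k.
    rewrite ik H3; first by rewrite /s2 write_eq.
    by apply/mapP => -[a]; rewrite mem_below => /andP[ka _] [E]; rewrite E ltnn in ka.
  apply: H3'; rewrite mem_below -jk ij andbT.
  by move: ji; rewrite leq_eqVlt => /predU1P[/val_inj E|//]; rewrite -E jk eqxx in ik.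
Qed.

Lemma value_codeP (s0 : V -> R) : mx_support S \subset F ->
  (forall i j, (i, j) \in F -> s0 (WX' i j) = X i j) ->
  (forall i, s0 (WL' i i) = L i i) ->
  (forall d, s0 (inp d) = init D x (inp d)) ->
  s0 logsum = 0 -> s0 inner = 0 ->
  exists s, rexec s0 (value_code P) = Some s /\
    s (Output ord0) = hfun C A S Mt y.
Proof.
move=> SF s0X s0L s0I s0log s0inn.
have [trig pos _] := XL.
have lt : (logsum == tmp) = false by apply/eqP.
have it : (inner == tmp) = false by apply/eqP.
have [|s1 [E1 H1]] := @rexec_loop_sum R V _ tmp
    (fun i => [:: ILn tmp (WL' i i); IAdd logsum logsum tmp])
    (fun _ => logsum) (fun i => ln (L i i)) (enum 'I_n) s0.
  move=> i s _ Hs /=.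
  have -> : s (WL' i i) = L i i by rewrite Hs ?s0L //; apply/mapP => -[].
  rewrite pos /=; eexists; split; first reflexivity.
  by move=> c ct; rewrite /write eqxx (negbTE ct) lt; case: eqP => [->|_]; rewrite ?addr0.
rewrite /value_code; apply: (rexec_catP E1).
have s1o c : c != tmp -> c != logsum -> s1 c = s0 c.
  move=> ct cl; rewrite H1 // big_pred0 ?addr0 // => q.
  by rewrite eq_sym; apply/negbTE.
have [|s2 [E2 H2]] := @rexec_loop_sum R V _ tmp
    (fun ij : 'I_n * 'I_n => [:: ISub tmp (WX' ij.1 ij.2) (inp (DS ij.1 ij.2));
                   IMul tmp (inp (DM ij.1 ij.2)) tmp; IAdd inner inner tmp])
    (fun _ => inner) (fun ij => Mt ij.1 ij.2 * (X ij.1 ij.2 - S ij.1 ij.2))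
    (enum F) s1.
  move=> [i j] s; rewrite mem_enum => ij Hs /=.
  eexists; split; first reflexivity.
  have sI d : s (inp d) = init D x (inp d).
    by rewrite Hs ?s1o ?s0I //; apply/mapP => -[].
  have sX : s (WX' i j) = X i j.
    by rewrite Hs ?s1o ?s0X //; apply/mapP => -[].
  have sS : s (inp (DS i j)) = S i j by rewrite sI /= inE ij.
  move=> c ct; rewrite /write !eqxx (negbTE ct) it /= sS sX sI init_M //.
  by case: eqP => [->|_]; rewrite ?addr0.
apply: (rexec_catP E2).
eexists; split; first reflexivity.
have lw : (logsum == two) = false by apply/eqP.
have il : (inner == logsum) = false by apply/eqP.
have iw : (inner == two) = false by apply/eqP.
rewrite /write !eqxx il iw lw !H2 ?lt ?it //.
rewrite [X in _ * (_ + X)]big_pred0 => [|q]; last by rewrite il.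
rewrite addr0 H1 ?lt // (s1o inner) ?it ?il // s0log s0inn !add0r.
rewrite /hfun (cholesky_factor_ln_det XL); congr (_ + _).
  rewrite big_mkcond big_enum /=; congr (_ * _).
  by apply: eq_bigr => i _; rewrite eqxx.
rewrite (eq_bigl xpredT) => [|q]; last by rewrite eqxx.
rewrite big_enum /= /inner_mx pair_bigA /= [RHS](bigID (fun q => q \in F)) /=.
(* Off F both X and [S] vanish, so the entries of [Mt] that are not stored contribute nothing. *)
rewrite [X in _ = _ + X]big1 ?addr0 => [|[i j] /= ij].
  by apply: eq_bigr => -[i j] _; rewrite !mxE.
have Sij : S i j = 0.
  by apply/eqP; apply: contraNT ij => Sij; apply: (fintype.subsetP SF); rewrite inE.
by rewrite [(_ - S) i j]mxE [(- S) i j]mxE Sij slack_support // subrr mulr0.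
Qed.

(** The common beginning of the evaluation program and the gradient program. *)
Lemma form_cholesky_codeP : exists s,
  [/\ rexec (init D x) (form_code P ++ cholesky_code P) = Some s,
      forall c, c != tmp -> (forall i j, c <> WL' i j) ->
        s c = if c is Work (WX i j) then X i j else init D x c
    & forall i j : 'I_n, (i, j) \in F -> (j <= i)%N -> s (WL' i j) = L i j].
Proof.
have [s1 [E1 H1]] := form_codeP.
have [|s2 [E2 [H2 H2']]] := @cholesky_codeP s1; first by move=> i j _; rewrite H1.
exists s2; split=> //; first by rewrite rexec_cat E1.
by move=> c ct cL; rewrite H2 // H1.
Qed.

Lemma eval_programP : mx_support S \subset F ->
  computes (eval_program P) D x (fun _ => hfun C A S Mt y).
Proof.
move=> SF.
have [s [E H H']] := form_cholesky_codeP.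
have [|||||s' [E' Hs']] := @value_codeP s SF.
- by move=> i j _; rewrite H.
- by move=> i; rewrite H' // fill_diag.
- by move=> d; rewrite H.
- by rewrite H //; apply/eqP.
- by rewrite H //; apply/eqP.
exists s'; split; last by move=> o; rewrite ord1.
by apply: rexec_exec; rewrite /= catA rexec_cat E.
Qed.

End EvalProgram.

(** * The gradient program *)

Section GradCode.
Context (n m : nat) (P : pattern n m).

(** The summand ['I_1] receives the output cell of the evaluation program, which makes [embed_cell]
    total and injective; ['I_n * 'I_n] holds the entries of X^-1. *)
Definition grad_work : finType := (('I_1 + eval_work n) + 'I_n * 'I_n)%type.

Definition embed_cell (c : cell (data n m) 'I_1 (eval_work n)) :
    cell (data n m) 'I_m grad_work :=
  match c with
  | Input d => Input d
  | Output o => Work (inl (inl o))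
  | Work w => Work (inl (inr w))
  end.

Local Notation inp d := (@Input (data n m) 'I_m grad_work d).
Local Notation out p := (@Output (data n m) 'I_m grad_work p).
Local Notation L i j := (@Work (data n m) 'I_m grad_work (inl (inr (WL i j)))).
Local Notation Z i j := (@Work (data n m) 'I_m grad_work (inr (i, j))).
Local Notation tmp := (@Work (data n m) 'I_m grad_work (inl (inr Wtmp))).

(* The products only involve positions (i, k) with i, k in [below P j], which
   lie in the chordal pattern. *)
Definition inverse_column_code (j : 'I_n) :
    seq (instr (cell (data n m) 'I_m grad_work)) :=
  flatten [seq [:: IMul tmp (Z i k) (L k j); ISub (Z i j) (Z i j) tmp]
          | i <- below P j, k <- below P j] ++
  [seq IDiv (Z i j) (Z i j) (L j j) | i <- below P j] ++
  [seq ICopy (Z j i) (Z i j) | i <- below P j] ++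
  [:: IConst (Z j j) 1; IDiv (Z j j) (Z j j) (L j j)] ++
  flatten [seq [:: IMul tmp (Z k j) (L k j); ISub (Z j j) (Z j j) tmp]
          | k <- below P j] ++
  [:: IDiv (Z j j) (Z j j) (L j j)].

Definition inverse_code := flatten [seq inverse_column_code (rev_ord k) | k <- enum 'I_n].

Definition output_code : seq (instr (cell (data n m) 'I_m grad_work)) :=
  flatten [seq [:: IAdd tmp (Z ij.1 ij.2) (inp (DM ij.1 ij.2));
                   IMul tmp tmp (inp (DA p ij.1 ij.2));
                   ISub (out p) (out p) tmp]
          | p <- enum 'I_m, ij <- enum (patA P p)].

Definition grad_program : program (data n m) 'I_m :=
  @Program (data n m) 'I_m grad_work
    (map (map_instr embed_cell) (form_code P ++ cholesky_code P) ++
     inverse_code ++ output_code).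

Lemma embed_cell_inj : injective embed_cell.
Proof. by move=> [d|o|w] [d'|o'|w'] //= [->]. Qed.

End GradCode.

Section GradProgram.
Context (R : realType) (n m : nat) (C : 'M[R]_n) (A : 'I_m -> 'M[R]_n).
Context (S Mt : 'M[R]_n) (y : 'rV[R]_m).
Local Notation P := (pattern_of C A).
Local Notation F := (chordal P).
Local Notation D := (data_stored P).
Local Notation x := (data_val C A S Mt y).
Local Notation V := (cell (data n m) 'I_m (grad_work n)).
Local Notation inp d := (@Input (data n m) 'I_m (grad_work n) d).
Local Notation out p := (@Output (data n m) 'I_m (grad_work n) p).
Local Notation WL' i j := (@Work (data n m) 'I_m (grad_work n) (inl (inr (WL i j)))).
Local Notation WZ' i j := (@Work (data n m) 'I_m (grad_work n) (inr (i, j))).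
Local Notation tmp := (@Work (data n m) 'I_m (grad_work n) (inl (inr Wtmp))).
Local Notation X := (slack C A y).

Hypothesis symC : symmetric_mx C.
Hypothesis symA : forall p, symmetric_mx (A p).
Context (L : 'M[R]_n) (XL : cholesky_factor X L).

Let Z := invmx X.

Let ZC i j : Z i j = Z j i.
Proof. by have /matrixP/(_ j i) := invmx_sym (slack_sym y symC symA); rewrite mxE. Qed.

Lemma eq_WZ i j k l : (WZ' i j == WZ' k l) = ((i, j) == (k, l)).
Proof. by apply/eqP/eqP => -[-> ->]. Qed.

(** The source of the column recurrence. For [i > j] the entry of [Z *m L] is 0, so [Z i j * L j j]
    is minus the sum; for [i = j] it is [(L j j)^-1], so [Z j j * L j j] is [(L j j)^-1] minus the
    sum. *)
Lemma sum_below_inverse (i j : 'I_n) :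
  \sum_(k <- below P j) Z i k * L k j = (Z *m L) i j - Z i j * L j j.
Proof.
have [trig pos _] := XL.
rewrite big_filter big_enum_cond /= mxE [in RHS](bigD1 j) //= addrAC subrr add0r.
rewrite [RHS](bigID (fun k : 'I_n => (j < k)%N && ((k, j) \in F))) /=.
rewrite [X in _ = _ + X]big1 ?addr0 => [|k /andP[kj]].
  apply: eq_bigl => k; case: (ltngtP k j) => kj; rewrite ?andbF //= ?andbT.
  by rewrite -val_eqE /= gtn_eqF.
rewrite negb_and => /orP[|/(factor_support symC symA XL) ->]; last by rewrite mulr0.
rewrite -leqNgt => kj'; rewrite trig ?mulr0 //.
by rewrite ltn_neqAle kj' andbT.
Qed.

(** The last clause is needed by the next column, whose subtractions start from these zeros. *)
Let inv_state (s0 : V -> R) (t : nat) (s : V -> R) : Prop :=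
  [/\ forall c, c != tmp -> (forall i j, c <> WZ' i j) -> s c = s0 c,
      forall i j : 'I_n, (i, j) \in F -> (t <= i)%N -> (t <= j)%N ->
        s (WZ' i j) = Z i j
    & forall i j : 'I_n, (i < t)%N || (j < t)%N -> s (WZ' i j) = 0].

Lemma inverse_column_codeP (s0 s : V -> R) (j : 'I_n) :
  (forall i k : 'I_n, (i, k) \in F -> (k <= i)%N -> s0 (WL' i k) = L i k) ->
  inv_state s0 j.+1 s ->
  exists s', rexec s (inverse_column_code P j) = Some s' /\ inv_state s0 j s'.
Proof.
move=> s0L [Hs HsZ Hs0].
have [trig pos _] := XL.
have sL k : k \in below P j -> s (WL' k j) = L k j.
  by rewrite mem_below => /andP[jk kj]; rewrite Hs // s0L // ltnW.
have sLj : s (WL' j j) = L j j by rewrite Hs // s0L ?fill_diag.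
have Lj0 : L j j != 0 by rewrite gt_eqF.
have Nj i : i \in below P j -> (i == j) = false.
  by rewrite mem_below => /andP[ji _]; rewrite -val_eqE /= gtn_eqF.
have Nj' i : i \in below P j -> (j == i) = false by move=> /Nj; rewrite eq_sym.
rewrite /inverse_column_code allpairs_map_pair.
set prs := [seq (i, k) | i <- below P j, k <- below P j].
have prsE q : q \in prs -> q.1 \in below P j /\ q.2 \in below P j.
  by move=> /allpairsP[[a b] [? ? ->]].
have notcol (l : seq 'I_n) c : (forall i, c <> WZ' i j) ->
   c \notin [seq WZ' i j | i <- l].
  by move=> H; apply/mapP => -[i _ /H].
have [|s1 [E1 H1]] := @rexec_loop_mul_sub R V _ tmp
   (fun q : 'I_n * 'I_n => WZ' q.1 q.2) (fun q => WL' q.2 j)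
   (fun q => WZ' q.1 j) prs s.
  move=> q /prsE[q1 q2]; apply/and5P; split=> //; apply/mapP => -[[a b] _] // [] _ /eqP.
  by rewrite Nj.
apply: (rexec_catP E1).
(* The products use only [Z] at indices above [j], already correct; subtracted from 0 they give
   [Z i j * L j j]. *)
have s1Z i : i \in below P j -> s1 (WZ' i j) = Z i j * L j j.
  move=> ib; rewrite H1 // Hs0 ?ltnSn ?orbT // sub0r.
  rewrite big_mkcond big_allpairs_dep /=.
  rewrite (eq_big_seq (fun a => if a == i then \sum_(k <- below P j) Z a k * L k j else 0)).
    rewrite -big_mkcond /=.
    rewrite (big_uniq_pred1 i (fun a => \sum_(k <- below P j) Z a k * L k j) (below_uniq P j)) ib.
    move: (ib); rewrite sum_below_inverse mem_below => /andP[ji _].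
    by rewrite (cholesky_factor_inv_mul_lower XL) // sub0r opprK.
  move=> a ab; rewrite (_ : (a == i) = (WZ' a j == WZ' i j)); last first.
    by rewrite eq_WZ xpair_eqE eqxx andbT.
  case: ifP => _; last by rewrite big1.
  apply: eq_big_seq => k kb; rewrite sL // HsZ //.
  - exact: (below_closed (aggregate_sym symC symA) ab kb).
  - by move: ab; rewrite mem_below => /andP[].
  - by move: kb; rewrite mem_below => /andP[].
have s1o c : c != tmp -> (forall i, i \in below P j -> c <> WZ' i j) -> s1 c = s c.
  move=> ct H; rewrite H1 // big1_seq ?subr0 // => q /andP[/eqP qc /prsE[q1 _]].
  by case: (H q.1).
have [||s2 [E2 [H2 H2']]] := @rexec_loop_write R V _
    (fun i => IDiv (WZ' i j) (WZ' i j) (WL' j j)) (fun i => WZ' i j)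
    (fun i => Z i j) (below P j) s1.
- by rewrite map_inj_uniq ?below_uniq // => i i' [].
- move=> i u ib Hu Hui /=; rewrite Hui s1Z // Hu; last exact: notcol.
  by rewrite s1o // sLj (negbTE Lj0) mulfK.
apply: (rexec_catP E2).
(* Both triangles are stored, because the columns still to come read [Z i k] for indices in either
   order. *)
have [||s3 [E3 [H3 H3']]] := @rexec_loop_write R V _
    (fun i => ICopy (WZ' j i) (WZ' i j)) (fun i => WZ' j i)
    (fun i => Z j i) (below P j) s2.
- by rewrite map_inj_uniq ?below_uniq // => i i' [].
- move=> i u ib Hu Hui /=; rewrite Hu ?H2' // 1?ZC //.
  by apply/mapP => -[a ab [/eqP]]; rewrite Nj.
apply: (rexec_catP E3).
have s3o c : (forall i, i \in below P j -> c <> WZ' i j /\ c <> WZ' j i) ->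
    c != tmp -> s3 c = s c.
  move=> H ct; rewrite H3; last by apply/mapP => -[i /H[_ ?]].
  by rewrite H2 ?s1o //; [move=> i /H[]|apply/mapP => -[i /H[? _]]].
pose s4 := write (write s3 (WZ' j j) 1) (WZ' j j) (L j j)^-1.
have E4 : rexec s3 [:: IConst (WZ' j j) 1; IDiv (WZ' j j) (WZ' j j) (WL' j j)] = Some s4.
  rewrite /= {1}/write /= s3o // sLj (negbTE Lj0) /=; congr Some.
  by rewrite /s4; congr write; rewrite write_eq write_neq // s3o // sLj mul1r.
apply: (rexec_catP E4).
have s4E c : c != WZ' j j -> s4 c = s3 c by move=> cj; rewrite /s4 !write_neq.
have [|s5 [E5 H5]] := @rexec_loop_mul_sub R V _ tmp
   (fun k => WZ' k j) (fun k => WL' k j) (fun _ => WZ' j j) (below P j) s4.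
  move=> k kb; apply/and5P; split=> //; apply/mapP => -[a _] // [/eqP].
  by rewrite Nj.
apply: (rexec_catP E5).
have s5o c : c != tmp -> c != WZ' j j -> s5 c = s3 c.
  move=> ct cj; rewrite (H5 _ ct) (s4E _ cj) big_pred0 ?subr0 // => k.
  by rewrite eq_sym; apply/negbTE.
have s5j : s5 (WZ' j j) = Z j j * L j j.
  rewrite H5 // /s4 write_eq (eq_bigl xpredT) => [|k]; last by rewrite eqxx.
  rewrite (eq_big_seq (fun k => Z j k * L k j)).
    by rewrite sum_below_inverse (cholesky_factor_inv_mul_diag XL) subKr.
  move=> k kb; rewrite !write_neq ?eq_WZ ?xpair_eqE ?eqxx ?Nj //.
  rewrite (s3o (WL' k j)) // sL // H3; last first.
    by apply/mapP => -[a ab [/eqP]]; rewrite Nj.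
  by rewrite H2' // ZC.
exists (write s5 (WZ' j j) (Z j j)); split.
  by rewrite /= s5o // s3o // sLj (negbTE Lj0) s5j mulfK.
have ne (i k : 'I_n) : (i, k) != (j, j) -> WZ' i k != WZ' j j by rewrite eq_WZ.
have Zt (i k : 'I_n) : WZ' i k != tmp by [].
split=> [c ct cZ|i k ik ji jk|i k ikj].
- have cj : c != WZ' j j by apply/eqP => /cZ.
  by rewrite (write_neq _ _ cj) (s5o _ ct cj) s3o ?Hs.
- have [[-> ->]|ikj] := eqVneq (i, k) (j, j); first by rewrite write_eq.
  rewrite (write_neq _ _ (ne _ _ ikj)) (s5o _ (Zt i k) (ne _ _ ikj)).
  have [ij|ij] := eqVneq i j.
    rewrite ij; apply: H3'; rewrite mem_below -ij (chordal_sym symC symA ik) andbT.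
    rewrite ltn_neqAle ij jk andbT; apply: contraNneq ikj => /val_inj <-.
    by rewrite ij.
  have ji' : (j < i)%N by rewrite ltn_neqAle ji andbT eq_sym.
  have [kj|kj] := eqVneq k j.
    rewrite kj H3; last by apply/mapP => -[a _ [/eqP]]; rewrite (negbTE ij).
    by apply: H2'; rewrite mem_below ji' -kj.
  have jk' : (j < k)%N by rewrite ltn_neqAle jk andbT eq_sym.
  rewrite s3o ?HsZ // => a _.
  by split=> -[/eqP + /eqP]; rewrite ?(negbTE ij) ?(negbTE kj).
- have njj : (i, k) != (j, j).
    by apply: contraTneq ikj => -[-> ->]; rewrite ltnn.
  rewrite (write_neq _ _ (ne _ _ njj)) (s5o _ (Zt i k) (ne _ _ njj)) s3o; first last.
  + by [].
  + move=> a; rewrite mem_below => /andP[ja _]; split=> -[E1' E2'];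
    by move: ikj; rewrite E1' E2' ltnn ?(ltnNge a) ?(ltnW ja) ?orbF.
  + by apply: Hs0; move: ikj; rewrite !ltnS => /orP[/ltnW ->|/ltnW ->]; rewrite ?orbT.
Qed.

Lemma inverse_codeP (s0 : V -> R) :
  (forall i k : 'I_n, (i, k) \in F -> (k <= i)%N -> s0 (WL' i k) = L i k) ->
  (forall i j, s0 (WZ' i j) = 0) ->
  exists s, [/\ rexec s0 (inverse_code P) = Some s,
    forall c, c != tmp -> (forall i j, c <> WZ' i j) -> s c = s0 c
    & forall i j, (i, j) \in F -> s (WZ' i j) = Z i j].
Proof.
move=> s0L s0Z.
have [||s [E [Hs Hs' _]]] := @rexec_loop_ord R V n
  (fun k => inverse_column_code P (rev_ord k))
  (fun k => inv_state s0 (n - k)) s0.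
- rewrite subn0; split=> // i j.
  by rewrite (leqNgt n) ltn_ord.
- move=> k s Hs; apply: inverse_column_codeP => //=.
  (* [rev_ord k] has value [n - k.+1], so [n - k] is its successor, the index at which the column
     step starts. *)
  by rewrite subnSK.
by exists s; split=> // i j ij; apply: Hs'; rewrite // subnn.
Qed.

Lemma output_codeP (s0 : V -> R) :
  (forall d, s0 (inp d) = init D x (inp d)) ->
  (forall i j, (i, j) \in F -> s0 (WZ' i j) = Z i j) ->
  (forall p, s0 (out p) = 0) ->
  exists s, rexec s0 (output_code P) = Some s /\
    forall p, s (out p) = - inner_mx (Z + Mt) (A p).
Proof.
move=> s0I s0Z s0O; rewrite /output_code allpairs_map_pair.
set l := [seq (p, ij) | p <- _, ij <- _].
have [|s [E H]] := @rexec_loop_sum R V _ tmp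
    (fun q : 'I_m * ('I_n * 'I_n) =>
       [:: IAdd tmp (WZ' q.2.1 q.2.2) (inp (DM q.2.1 q.2.2));
           IMul tmp tmp (inp (DA q.1 q.2.1 q.2.2));
           ISub (out q.1) (out q.1) tmp])
    (fun q => out q.1)
    (fun q => - ((Z q.2.1 q.2.2 + Mt q.2.1 q.2.2) * A q.1 q.2.1 q.2.2)) l s0.
  move=> [p [i j]] s /allpairsPdep[p' [ij [_ + [-> ijE]]]].
  rewrite mem_enum -{}ijE /= => ijA Hs.
  have ijF : (i, j) \in F.
    exact: (@patA_chordal _ _ P p').
  have sI d : s (inp d) = init D x (inp d) by rewrite Hs ?s0I //; apply/mapP => -[].
  have sZ : s (WZ' i j) = Z i j by rewrite Hs ?s0Z //; apply/mapP => -[].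
  eexists; split; first reflexivity.
  move=> c ct; rewrite /write !eqxx (negbTE ct) /= sZ.
  rewrite (sI (DM i j)) (sI (DA _ i j)) init_M // init_A.
  by case: eqP => [->|_]; rewrite ?addr0.
exists s; split=> [//|p].
rewrite H // s0O add0r sumrN; congr (- _).
rewrite big_mkcond big_allpairs_dep /= big_enum /= (bigD1 p) //=.
rewrite [X in _ + X]big1 ?addr0 => [|p' /negbTE pp']; last first.
  rewrite big1 // => ij _; case: eqP => // -[E1].
  by rewrite E1 eqxx in pp'.
under eq_bigr do rewrite eqxx.
rewrite big_enum /= /inner_mx pair_bigA /= [RHS](bigID (fun q => q \in patA P p)) /=.
rewrite [X in _ = _ + X]big1 ?addr0 => [|[i j]].
  by apply: eq_bigr => -[i j] _; rewrite [(Z + Mt) i j]mxE.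
by rewrite inE negbK /= => /eqP ->; rewrite mulr0.
Qed.

(** Stated with [rexec], since forward differentiation requires a run without a square root at 0. *)
Lemma grad_program_rexec : exists s,
  rexec (init D x) (Defs.code (grad_program P)) = Some s /\
  forall p, s (Output p) = - inner_mx (invmx X + Mt) (A p).
Proof.
have [s1 [E1 H1 H1']] := form_cholesky_codeP S Mt symC symA XL.
have [|s2 [E2 H2 H2']] := @rexec_map_instr R _ _ _ (@embed_cell_inj n m)
  _ _ (init D x) _ _ E1; first by case.
have s2o c : (forall c', c <> embed_cell c') -> s2 c = init D x c by exact: H2'.
apply: (rexec_catP E2).
have [||s3 [E3 H3 H3']] := @inverse_codeP s2.
- by move=> i k ik ki; rewrite (H2 (Work (WL i k))) H1'.
- by move=> i j; rewrite s2o // => -[].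
apply: (rexec_catP E3).
apply: output_codeP => //.
- move=> d; rewrite H3 // (H2 (Input d)) H1 //.
- by move=> p; rewrite H3 // s2o // => -[].
Qed.

End GradProgram.

(** * Derivatives of h *)

Section MatrixCalculus.
Context (R : realType).

Lemma is_derive_line (V : normedModType R) (f : V -> R) (x v : V) (d : R) :
  is_derive (0 : R) (1 : R) (fun t => f (t *: v + x)) d -> is_derive x v f d.
Proof.
case=> df <-; apply: DeriveDef; first exact/derivable1P.
rewrite /derive; set g1 := fun h => h^-1 *: _; set g2 := fun h => h^-1 *: _.
suff -> : g1 = g2 by [].
by rewrite funeqE /g1 /g2 => h /=; rewrite addr0 scale0r add0r [_%:A]mulr1.
Qed.

Lemma is_derive_bigsum (I : Type) (r : seq I) (f : I -> R -> R) (df : I -> R) :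
  (forall i, is_derive (0 : R) (1 : R) (f i) (df i)) ->
  is_derive (0 : R) (1 : R) (fun t => \sum_(i <- r) f i t) (\sum_(i <- r) df i).
Proof.
move=> H; elim: r => [|i r IH].
  under eq_fun do rewrite big_nil; rewrite big_nil; exact: is_derive_cst.
under eq_fun do rewrite big_cons; rewrite big_cons.
exact: is_deriveD (H i) IH.
Qed.

Lemma is_derive_mul (f g : R -> R) (df dg : R) :
  is_derive (0 : R) (1 : R) f df -> is_derive (0 : R) (1 : R) g dg ->
  is_derive (0 : R) (1 : R) (fun t => f t * g t) (df * g 0 + f 0 * dg).
Proof.
move=> hf hg; apply: (is_derive_eq (is_deriveM hf hg)).
by rewrite /GRing.scale /= addrC mulrC.
Qed.

(** The products over the other factors replace the logarithmic derivative, as factors may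
    vanish. *)
Lemma is_derive_bigprod (I : eqType) (r : seq I) (f : I -> R -> R) (df : I -> R) :
  uniq r -> (forall i, is_derive (0 : R) (1 : R) (f i) (df i)) ->
  is_derive (0 : R) (1 : R) (fun t => \prod_(i <- r) f i t)
    (\sum_(i <- r) df i * \prod_(j <- r | j != i) f j 0).
Proof.
move=> + H; elim: r => [_|i r IH /= /andP[ir /IH{}IH]].
  by under eq_fun do rewrite big_nil; rewrite big_nil; exact: is_derive_cst.
under eq_fun do rewrite big_cons; rewrite big_cons.
apply: (is_derive_eq (is_derive_mul (H i) IH)); congr (_ * _ + _).
  rewrite big_cons eqxx /= big_seq [RHS]big_seq_cond; apply: eq_bigl => j.
  by case: eqP => [->|]; rewrite ?andbT // andbF; apply/negbTE.
rewrite big_distrr /=; apply: eq_big_seq => j jr.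
rewrite big_cons ifT; last by apply: contraNneq ir => ->.
by rewrite mulrCA.
Qed.

Definition mx_is_derive n (M : R -> 'M[R]_n) (dM : 'M[R]_n) : Prop :=
  forall i j, is_derive (0 : R) (1 : R) (fun t => M t i j) (dM i j).

(** Jacobi's formula, by differentiating the Leibniz expansion term by term. *)
Lemma is_derive_det n (M : R -> 'M[R]_n) (dM : 'M[R]_n) : mx_is_derive M dM ->
  is_derive (0 : R) (1 : R) (fun t => \det (M t))
    (\sum_i \sum_j dM i j * cofactor (M 0) i j).
Proof.
move=> H.
have Hs (s : {perm 'I_n}) : is_derive (0 : R) (1 : R)
    (fun t => (-1) ^+ s * \prod_i M t i (s i))
    ((-1) ^+ s * \sum_i dM i (s i) * \prod_(j | j != i) M 0 j (s j)).
  have Hp := @is_derive_bigprod _ (index_enum 'I_n) (fun i t => M t i (s i))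
    (fun i => dM i (s i)) (index_enum_uniq _) (fun i => H i (s i)).
  by apply: (is_derive_eq (is_derive_mul (is_derive_cst _ _ _) Hp)); rewrite mul0r add0r.
apply: (is_derive_eq (is_derive_bigsum _ Hs)).
(* [N i] is [M 0] with row [i] replaced by its derivative; expanding along that row brings in the
   cofactors. *)
pose N i := \matrix_(k, j) (if k == i then dM i j else M 0 k j).
transitivity (\sum_i \det (N i)).
  under eq_bigr do rewrite big_distrr /=.
  rewrite exchange_big /=; apply: eq_bigr => i _; apply: eq_bigr => s _.
  rewrite [in RHS](bigD1 i) //= mxE eqxx; congr (_ * (_ * _)).
  by apply: eq_bigr => j /negbTE ji; rewrite mxE ji.
apply: eq_bigr => i _; rewrite (expand_det_row _ i); apply: eq_bigr => j _.
rewrite mxE eqxx; congr (_ * (_ * \det _)); apply/matrixP => k l.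
by rewrite !mxE eq_sym (negbTE (neq_lift _ _)).
Qed.

(** Differentiating [M(t) M(t)^-1 = 1] gives the value once the derivative is known to exist.
    Existence comes from the cofactor formula, valid near 0 where the determinant does not
    vanish. *)
Lemma mx_is_derive_inv n (M : R -> 'M[R]_n) (dM : 'M[R]_n) :
  mx_is_derive M dM -> M 0 \in unitmx ->
  mx_is_derive (fun t => invmx (M t)) (- (invmx (M 0) *m dM *m invmx (M 0))).
Proof.
move=> H uM.
have dD := is_derive_det H.
have d0 : \det (M 0) != 0 by rewrite -unitfE -unitmxE.
have ndet : \forall t \near (0 : R), M t \in unitmx.
  by apply: filterS (is_derive_near_neq0 dD d0) => t; rewrite unitmxE unitfE.
have [dZ HZ] : exists dZ, mx_is_derive (fun t => invmx (M t)) dZ.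
  have Hcof i j : exists dc, is_derive (0 : R) (1 : R) (fun t => cofactor (M t) i j) dc.
    have Hm : mx_is_derive (fun t => row' i (col' j (M t))) (row' i (col' j dM)).
      move=> k l; have := H (lift i k) (lift j l); rewrite !mxE.
      by under [in X in _ -> X]eq_fun do rewrite !mxE.
    have Hc := is_derive_mul (is_derive_cst ((-1) ^+ (i + j) : R) _ _) (is_derive_det Hm).
    by eexists; exact: Hc.
  have Hent i j : exists d, is_derive (0 : R) (1 : R) (fun t => invmx (M t) i j) d.
    have [dc Hc] := Hcof j i; have Hd := is_derive_div Hc dD d0; eexists.
    apply: near_eq_is_derive Hd.
    apply: filterS ndet => t ut.
    by rewrite /invmx ut !mxE mulrC.
  exists (\matrix_(i, j) 'D_1 (fun t => invmx (M t) i j) 0) => i j.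
  by have [d Hd] := Hent i j; rewrite mxE; apply: derivableP; case: Hd.
suff -> : - (invmx (M 0) *m dM *m invmx (M 0)) = dZ by [].
have E : dM *m invmx (M 0) + M 0 *m dZ = 0.
  apply/matrixP => i j; rewrite !mxE -big_split /=.
  have H1 := is_derive_bigsum (index_enum 'I_n)
    (fun k => is_derive_mul (H i k) (HZ k j)).
  have H2 : is_derive (0 : R) (1 : R)
      (fun t => \sum_k M t i k * invmx (M t) k j) (0 : R).
    apply: (near_eq_is_derive _ (is_derive_cst ((1%:M : 'M[R]_n) i j : R) _ _)).
    apply: filterS ndet => t ut; rewrite /cst -(mulmxV ut) mxE //.
  by rewrite -(@derive_val _ _ _ _ _ _ _ H1) (@derive_val _ _ _ _ _ _ _ H2).
move/eqP: E; rewrite addr_eq0 => /eqP E.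
by rewrite -mulmxA E mulmxN opprK mulKmx.
Qed.

End MatrixCalculus.

(** * The inner product as a trace *)

Section Inner.
Context (R : realType) (n : nat).
Implicit Types U W : 'M[R]_n.

Lemma inner_mx_tr U W : inner_mx U W = \tr (U *m W^T).
Proof.
rewrite /inner_mx /mxtrace; apply: eq_bigr => i _; rewrite mxE.
by apply: eq_bigr => j _; rewrite mxE.
Qed.

Lemma inner_mxDl U1 U2 W : inner_mx (U1 + U2) W = inner_mx U1 W + inner_mx U2 W.
Proof. by rewrite !inner_mx_tr mulmxDl linearD. Qed.

Lemma inner_mxNr U W : inner_mx U (- W) = - inner_mx U W.
Proof. by rewrite !inner_mx_tr linearN mulmxN linearN. Qed.

Lemma inner_mx_sum U m (z : 'rV[R]_m) (A : 'I_m -> 'M[R]_n) :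
  inner_mx U (\sum_p z 0 p *: A p) = \sum_p z 0 p * inner_mx U (A p).
Proof.
rewrite inner_mx_tr linear_sum mulmx_sumr linear_sum /=.
by apply: eq_bigr => p _; rewrite linearZ /= -scalemxAr linearZ /= inner_mx_tr.
Qed.

(** Cyclicity of the trace. It frees the direction of its sandwich, so that the inner product can be
    expanded linearly in it. *)
Lemma inner_mx_sandwich Z U W : symmetric_mx U -> symmetric_mx W ->
  inner_mx (Z *m U *m Z) W = inner_mx (Z *m W *m Z) U.
Proof.
move=> symU symW; rewrite !inner_mx_tr symU symW.
by rewrite -mulmxA mxtrace_mulC !mulmxA.
Qed.

End Inner.

(** * Gradient and Hessian of h *)

Section Derivatives.
Context (R : realType) (n m : nat) (C : 'M[R]_n) (A : 'I_m -> 'M[R]_n).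
Context (S Mt : 'M[R]_n).
Hypothesis symC : symmetric_mx C.
Hypothesis symA : forall p, symmetric_mx (A p).
Local Notation h := (hfun C A S Mt).
Local Notation B z := (\sum_p z 0 p *: A p).

Lemma slack_line (u z : 'rV[R]_m) t :
  slack C A (t *: z + u) = slack C A u + t *: (- B z).
Proof.
rewrite /slack -addrA; congr (C + _); rewrite scalerN -opprD; congr (- _).
rewrite scaler_sumr -big_split /=; apply: eq_bigr => p _.
by rewrite !mxE scalerDl scalerA addrC.
Qed.

Lemma slack_derive (u z : 'rV[R]_m) :
  mx_is_derive (fun t => slack C A (t *: z + u)) (- B z).
Proof.
move=> i j.
have -> : (fun t => slack C A (t *: z + u) i j) =
    (cst (slack C A u i j) + (fun t : R => t * (- B z) i j)).
  have addE (U W : 'M[R]_n) t : (U + t *: W) i j = U i j + t * W i j by rewrite !mxE.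
  by apply/funext => t; rewrite slack_line addE.
have Hm := is_derive_mul (is_derive_id _ _) (is_derive_cst ((- B z) i j : R) _ _).
apply: (is_derive_eq (is_deriveD (is_derive_cst (slack C A u i j : R) _ _) Hm)).
by rewrite add0r mul1r mulr0 addr0.
Qed.

(** Only positivity of the determinant is assumed: it persists along a line by continuity and is
    what differentiating the logarithm takes. *)
Lemma is_derive_hfun (u z : 'rV[R]_m) : 0 < \det (slack C A u) ->
  is_derive u z h (- inner_mx (invmx (slack C A u) + Mt) (B z)).
Proof.
move=> d0; apply: is_derive_line; rewrite /hfun.
have H := slack_derive u z.
have dD := is_derive_det H.
have E0 : slack C A (0 *: z + u) = slack C A u by rewrite scale0r add0r.
have d0' : 0 < \det (slack C A (0 *: z + u)) by rewrite E0.
have H1 := is_derive1_ln d0'.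
have H2 := @is_derive1_comp R (@ln R) (fun t => \det (slack C A (t *: z + u))) 0 _ _ H1 dD.
have H3 : is_derive (0 : R) (1 : R)
    (fun t => inner_mx Mt (slack C A (t *: z + u) - S)) (inner_mx Mt (- B z)).
  apply: is_derive_bigsum => i; apply: is_derive_bigsum => j.
  have Hm := is_derive_mul (is_derive_cst (Mt i j) _ _)
    (is_deriveB (H i j) (is_derive_cst (S i j) _ _)).
  under eq_fun do rewrite [(_ - S) i j]mxE [(- S) i j]mxE.
  by apply: (is_derive_eq Hm); rewrite mul0r add0r subr0.
apply: (is_derive_eq (is_deriveD H2 H3)).
rewrite E0 inner_mxDl opprD inner_mxNr; congr (_ + _).
rewrite -inner_mxNr /inner_mx big_distrr /=; apply: eq_bigr => i _.
rewrite big_distrr /=; apply: eq_bigr => j _.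
have ud : slack C A u \in unitmx by rewrite unitmxE unitfE gt_eqF.
rewrite mulrC -mulrA mulrC; congr (_ * _).
(* Cofactors divided by the determinant form the transpose of the inverse; symmetry removes the
   transpose. *)
have /matrixP/(_ j i) := invmx_sym (slack_sym u symC symA); rewrite mxE => ->.
by rewrite /invmx ud !mxE mulrC.
Qed.

Let B_basis p : B (basis_vec R p) = A p.
Proof.
rewrite (bigD1 p) //= big1 => [|q qp]; first by rewrite mxE !eqxx scale1r addr0.
by rewrite mxE (negbTE qp) andbF scale0r.
Qed.

Lemma partial_hfun (u : 'rV[R]_m) p : 0 < \det (slack C A u) ->
  partial h p u = - inner_mx (invmx (slack C A u) + Mt) (A p).
Proof.
move=> d0; have H := is_derive_hfun (basis_vec R p) d0.
by rewrite /partial (@derive_val _ _ _ _ _ _ _ H) B_basis.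
Qed.

(** Serves twice: with a basis vector it gives the entries of the Hessian, and with arbitrary [z]
    the quantity that forward mode computes. *)
Lemma is_derive_partial_hfun (u z : 'rV[R]_m) p : 0 < \det (slack C A u) ->
  is_derive (0 : R) (1 : R) (fun t => partial h p (t *: z + u))
    (- inner_mx (invmx (slack C A u) *m B z *m invmx (slack C A u)) (A p)).
Proof.
move=> d0.
have E0 : slack C A (0 *: z + u) = slack C A u by rewrite scale0r add0r.
have H := slack_derive u z.
have ud : slack C A (0 *: z + u) \in unitmx by rewrite E0 unitmxE unitfE gt_eqF.
have HZ := mx_is_derive_inv H ud.
have dnear : \forall t \near (0 : R), 0 < \det (slack C A (t *: z + u)).
  by apply: is_derive_near_gt0 (is_derive_det H) _; rewrite E0.
have Hi : is_derive (0 : R) (1 : R)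
    (fun t => inner_mx (invmx (slack C A (t *: z + u)) + Mt) (A p))
    (inner_mx (invmx (slack C A u) *m B z *m invmx (slack C A u)) (A p)).
  apply: is_derive_bigsum => i; apply: is_derive_bigsum => j.
  under eq_fun do rewrite [(_ + Mt) i j]mxE.
  have Hm := is_derive_mul (is_deriveD (HZ i j) (is_derive_cst (Mt i j : R) _ _))
    (is_derive_cst (A p i j : R) _ _).
  apply: (is_derive_eq Hm).
  by rewrite mulr0 addr0 addr0 mulmxN mulNmx opprK E0.
apply: (near_eq_is_derive _ (is_deriveN Hi)).
by apply: filterS dnear => t /partial_hfun ->.
Qed.

Lemma partial_partial_hfun (u : 'rV[R]_m) p q : 0 < \det (slack C A u) ->
  is_derive u (basis_vec R p) (partial h q)
    (- inner_mx (invmx (slack C A u) *m A p *m invmx (slack C A u)) (A q)).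
Proof.
move=> d0; apply: is_derive_line.
by have := is_derive_partial_hfun (basis_vec R p) q d0; rewrite B_basis.
Qed.

Lemma twice_derivable_hfun (u : 'rV[R]_m) : 0 < \det (slack C A u) ->
  twice_derivable h u.
Proof.
move=> d0; split=> [p|p q].
  by case: (is_derive_hfun (basis_vec R p) d0).
by case: (partial_partial_hfun p q d0).
Qed.

Lemma hessian_mul_hfun (u z : 'rV[R]_m) p : 0 < \det (slack C A u) ->
  (hessian h u *m z^T) p 0 =
  - inner_mx (invmx (slack C A u) *m B z *m invmx (slack C A u)) (A p).
Proof.
move=> d0; rewrite inner_mx_sandwich //; last first.
  rewrite /symmetric_mx linear_sum; apply: eq_bigr => q _.
  by rewrite linearZ /= symA.
rewrite inner_mx_sum -sumrN mxE; apply: eq_bigr => q _.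
have E := @derive_val _ _ _ _ _ _ _ (partial_partial_hfun p q d0).
rewrite !mxE /partial in E *; rewrite E.
by rewrite mulNr mulrC.
Qed.

End Derivatives.

(** * Forward-mode programs and costs *)

Section ForwardProgram.
Context (I O J : finType) (tan : I -> option J).
Hypothesis tan_inj : forall i i' j, tan i = Some j -> tan i' = Some j -> i = i'.
Context (P : program I O).

Definition forward_work : finType := (I + O + (work P + work P) + bool)%type.

(** [tan] selects the inputs that vary and names the new inputs holding their tangents. Primal
    outputs become work cells, because only their tangents are returned. *)
Definition prim_cell (c : cell I O (work P)) : cell (I + J) O forward_work :=
  match c with
  | Input i => Input (inl i)
  | Output o => Work (inl (inl (inr o)))
  | Work w => Work (inl (inr (inl w)))
  end.

(* An input without tangent gets a work cell that stays at 0. *)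
Definition tang_cell (c : cell I O (work P)) : cell (I + J) O forward_work :=
  match c with
  | Input i => if tan i is Some j then Input (inr j) else Work (inl (inl (inl i)))
  | Output o => Output o
  | Work w => Work (inl (inr (inr w)))
  end.

Definition forward_program : program (I + J)%type O :=
  @Program (I + J)%type O forward_work
    (forward_code prim_cell tang_cell (Work (inr false)) (Work (inr true)) (Defs.code P)).

Lemma time_forward_program : (time_cost forward_program <= 4 * time_cost P)%N.
Proof. exact: time_forward_code. Qed.

(** Each counted cell yields its primal and its tangent copy; the 2 counts the scratch cells. *)
Lemma space_forward_program (D : {set I}) (D2 : {set I + J}) :
  (forall i, inl i \in D2 -> i \in D) ->
  (forall j, inr j \in D2 -> exists2 i, i \in D & tan i = Some j) ->
  (space_cost forward_program D2 <= 2 * space_cost P D + 2)%N.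
Proof.
move=> HI HJ; rewrite /space_cost; set G := (X in (2 * #|pred_of_set X|)%N).
have GI i : i \in D -> Input i \in G by move=> iD; rewrite !inE imset_f.
have GO o : Output o \in G by rewrite !inE (imset_f (fun o => Output o)) ?orbT.
have GC c : c \in flatten (map (@instr_cells _) (Defs.code P)) -> c \in G.
  by move=> cP; rewrite !inE cP orbT.
apply: (@leq_trans #|(prim_cell @: G) :|: (tang_cell @: G) :|:
   [set Work (inr false); Work (inr true)]|).
  apply/subset_leq_card/fintype.subsetP => c.
  rewrite finset.in_setU finset.in_setU => /orP[/orP[|]|].
  - case/imsetP => -[i /HI /GI iG|j /HJ[i /GI iG ij]] ->; rewrite !finset.in_setU.
      by rewrite (imset_f prim_cell iG).
    by have := imset_f tang_cell iG; rewrite /= ij => ->; rewrite orbT.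
  - by case/imsetP => o _ ->; rewrite !finset.in_setU (imset_f tang_cell (GO o)) orbT.
  - rewrite inE => /cells_forward_code[->|->|[d /GC dG [->|->]]].
    + by rewrite !finset.in_setU !finset.in_set1 eqxx ?orbT.
    + by rewrite !finset.in_setU !finset.in_set1 eqxx ?orbT.
    + by rewrite !finset.in_setU (imset_f prim_cell dG).
    + by rewrite !finset.in_setU (imset_f tang_cell dG) orbT.
apply: leq_trans (leq_card_setU _ _) _; rewrite cards2 leq_add //.
apply: leq_trans (leq_card_setU _ _) _.
by rewrite mul2n -addnn leq_add // leq_imset_card.
Qed.

Lemma forward_programP (R : realType) (s : R -> cell I O (work P) -> R)
    (D2 : {set I + J}) (x2 : I + J -> R) u :
  (forall c, is_derive (0 : R) (1 : R) (s^~ c) (init D2 x2 (tang_cell c))) ->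
  (forall c, init D2 x2 (prim_cell c) = s 0 c) ->
  rexec (s 0) (Defs.code P) = Some u ->
  exists (u_ : R -> cell I O (work P) -> R) u',
    [/\ \forall t \near (0 : R), rexec (s t) (Defs.code P) = Some (u_ t),
        exec (init D2 x2) (Defs.code forward_program) = Some u'
      & forall x, is_derive (0 : R) (1 : R) (u_^~ x) (u' (tang_cell x))].
Proof.
move=> hs sp; apply: forward_codeP hs sp _ => //.
- by case=> [i|o|w] [i'|o'|w'] //= [->].
- move=> [i|o|w] [i'|o'|w'] //=; try (by case: (tan _)); try by case=> ->.
  case Ei: (tan i) => [j|]; case Ei': (tan i') => [j'|] // -[E].
    by rewrite E in Ei; rewrite (tan_inj Ei Ei').
  by rewrite E.
- by move=> [i|o|w] [i'|o'|w'] //=; case: (tan _).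
- by case.
- by case.
- by case=> //= i; case: (tan i).
- by case=> //= i; case: (tan i).
Qed.

End ForwardProgram.

(** * Time and space of the gradient program *)

Section Costs.
Context (n m : nat).

Lemma time_cat (V : Type) (cs1 cs2 : seq (instr V)) :
  (\sum_(c <- cs1 ++ cs2) instr_time c =
   \sum_(c <- cs1) instr_time c + \sum_(c <- cs2) instr_time c)%N.
Proof. exact: big_cat. Qed.

Lemma time_loop (V T : Type) (body : T -> seq (instr V)) k (l : seq T) :
  (forall q, \sum_(c <- body q) instr_time c = k)%N ->
  (\sum_(c <- flatten [seq body q | q <- l]) instr_time c = size l * k)%N.
Proof.
move=> H; rewrite big_flatten big_map /=.
by under eq_bigr do rewrite H; rewrite big_const_seq count_predT iter_addn_0 mulnC.
Qed.

Lemma time_map (V T : Type) (f : T -> instr V) k (l : seq T) :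
  (forall q, instr_time (f q) = k)%N ->
  (\sum_(c <- [seq f q | q <- l]) instr_time c = size l * k)%N.
Proof.
move=> H; rewrite big_map.
by under eq_bigr do rewrite H; rewrite big_const_seq count_predT iter_addn_0 mulnC.
Qed.

(** The factorization updates only a lower triangle, whereas the inverse loops over all pairs;
    exchanging the two indices shows that this at most doubles the count. *)
Lemma sqr_size_le_ordered_pairs (s : seq 'I_n) :
  (size s * size s <=
   2 * size [seq (i, j) | i : 'I_n <- s, j <- [seq j : 'I_n <- s | (j <= i)%N]])%N.
Proof.
have -> : size [seq (i, j) | i : 'I_n <- s, j <- [seq j : 'I_n <- s | (j <= i)%N]] =
    (\sum_(i <- s) \sum_(j <- s) (nat_of_ord j <= nat_of_ord i))%N.
  rewrite size_allpairs_dep sumnE big_map; apply: eq_bigr => i _.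
  by rewrite size_filter -sum1_count big_mkcond; apply: eq_bigr => j _; case: leqP.
set t := (\sum_(i <- s) _)%N.
have tE : (t = \sum_(i <- s) \sum_(j <- s) (nat_of_ord i <= nat_of_ord j))%N.
  exact: exchange_big.
have -> : (size s * size s = \sum_(i <- s) \sum_(j <- s) 1)%N.
  by rewrite !big_const_seq !count_predT !iter_addn_0 mul1n.
rewrite mul2n -addnn {2}tE /t -big_split /=.
apply: leq_sum => i _; rewrite -big_split /=; apply: leq_sum => j _.
by case: (leqP j i) => // /ltnW ->.
Qed.

Context (P : pattern n m).

(** With [d = size (below P k)] the exact count is [2 d^2 + 3 d + 2]. The bound is shaped for
    comparison with a factorization step, which costs at least [d^2 + d + 1]. *)
Let time_inverse_column_le (k : 'I_n) :
  (\sum_(c <- inverse_column_code P k) instr_time c <=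
   3 * (size (below P k) * size (below P k) + size (below P k) + 1))%N.
Proof.
rewrite /inverse_column_code !time_cat allpairs_map_pair.
rewrite (@time_loop _ _ _ 2 [seq (i, j) | i <- _, j <- _]); last first.
  by move=> q; rewrite !big_cons big_nil.
rewrite (@time_loop _ _ _ 2 (below P k)); last by move=> q; rewrite !big_cons big_nil.
rewrite (@time_map _ _ _ 1) // (@time_map _ _ _ 0) //.
rewrite size_allpairs !big_cons !big_nil /=.
by move: (size _) => d; lia.
Qed.

Let time_inverse_le :
  (\sum_(c <- inverse_code P) instr_time c <=
   3 * \sum_(c <- cholesky_code P) instr_time c)%N.
Proof.
rewrite /cholesky_code time_cat mulnDr; apply: leq_trans (leq_addl _ _).
rewrite /inverse_code !big_flatten 2!big_map !big_enum /=.
rewrite (reindex_inj rev_ord_inj) /= big_distrr /=; apply: leq_sum => k _.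
rewrite [rev_ord _]rev_ordK.
apply: leq_trans (time_inverse_column_le k) _; rewrite leq_mul2l /=.
rewrite big_cons time_cat allpairs_map_pair (@time_map _ _ _ 1) //.
rewrite (@time_loop _ _ _ 2); last by move=> q; rewrite !big_cons big_nil.
have := sqr_size_le_ordered_pairs (below P k).
move: (size (below P k)) (size _) => d t /=; lia.
Qed.

(** Each stored entry of an [A p] costs three operations here and two when forming the slack
    matrix. *)
Let time_output_le :
  (\sum_(c <- output_code P) instr_time c <=
   2 * \sum_(c <- form_code P) instr_time c)%N.
Proof.
rewrite /output_code /form_code time_cat allpairs_map_pair.
rewrite [X in (_ <= 2 * (_ + \sum_(_ <- flatten X) _))%N]allpairs_map_pair.
rewrite (@time_loop _ _ _ 3); last by move=> q; rewrite !big_cons big_nil.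
rewrite (@time_loop _ _ _ 2); last by move=> q; rewrite !big_cons big_nil.
rewrite mulnDr; apply: leq_trans (leq_addl _ _).
by rewrite mulnCA leq_mul2l orbT.
Qed.

Lemma time_grad_program : (time_cost (grad_program P) <= 4 * time_cost (eval_program P))%N.
Proof.
(* [f + c + i + o <= 3 f + 4 c]; the value code [v] only adds slack. *)
have le f c v i o : (o <= 2 * f -> i <= 3 * c -> f + c + (i + o) <= 4 * (f + (c + v)))%N.
  by clear; lia.
rewrite /time_cost /=; move: time_output_le time_inverse_le.
move: (form_code P) (cholesky_code P) (value_code P) (inverse_code P) (output_code P).
by move=> f c v i o; rewrite !time_cat time_map_instr !time_cat; exact: le.
Qed.

Let cells (V : Type) (cs : seq (instr V)) := flatten (map (@instr_cells V) cs).

Let cells_cat (V : Type) (cs1 cs2 : seq (instr V)) :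
  cells (cs1 ++ cs2) = cells cs1 ++ cells cs2.
Proof. by rewrite /cells map_cat flatten_cat. Qed.

Let all_cells_loop (V : Type) (T : eqType) (Q : pred V) (body : T -> seq (instr V)) l :
  {in l, forall q, all Q (cells (body q))} -> all Q (cells (flatten [seq body q | q <- l])).
Proof.
elim: l => //= q l IH H; rewrite cells_cat all_cat H ?mem_head // IH // => q' q'l.
by apply: H; rewrite inE q'l orbT.
Qed.

Let all_cells_map (V : Type) (T : eqType) (Q : pred V) (f : T -> instr V) l :
  {in l, forall q, all Q (instr_cells (f q))} -> all Q (cells [seq f q | q <- l]).
Proof.
elim: l => //= q l IH H; rewrite /cells /= all_cat H ?mem_head // IH // => q' q'l.
by apply: H; rewrite inE q'l orbT.
Qed.

Local Notation F := (chordal P).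
Local Notation D := (data_stored P).
Local Notation V := (cell (data n m) 'I_m (grad_work n)).
Local Notation WL' i j := (Work (inl (inr (WL i j))) : V).
Local Notation WZ' i j := (Work (inr (i, j)) : V).
Local Notation tmp := (Work (inl (inr Wtmp)) : V).

Hypothesis symE : sym_pattern (aggregate P).

(** Four groups of cells, each at most as large as the evaluation space: the embedded evaluation
    cells, X^-1 on F (charged to the stored entries of [Mt]), the outputs (charged to the entries of
    y), and the scratch cell (charged to the output of the evaluation). *)
Lemma space_grad_program :
  (space_cost (grad_program P) D <= 4 * space_cost (eval_program P) D)%N.
Proof.
rewrite /space_cost; set E := (X in (4 * #|pred_of_set X|)%N).
have ED d : d \in D -> Input d \in E by move=> dD; rewrite !inE imset_f.
have EL i j : (i, j) \in F -> (j <= i)%N -> Work (WL i j) \in E.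
  move=> ij ji; rewrite !finset.in_setU; apply/orP; right; rewrite inE /=.
  rewrite !map_cat !flatten_cat !mem_cat; apply/orP; right; apply/orP; left.
  apply/orP; left; rewrite -map_comp; apply/flatten_mapP; exists (i, j).
    by rewrite mem_filter mem_enum ji.
  by rewrite inE eqxx.
have F_le : (#|F| <= #|E|)%N.
  have inj : injective (fun ij : 'I_n * 'I_n =>
      Input (DM ij.1 ij.2) : cell (data n m) 'I_1 (eval_work n)).
    by move=> [a b] [c d] [-> ->].
  rewrite -(card_imset _ inj); apply/subset_leq_card/fintype.subsetP => c.
  by case/imsetP => -[i j] ij ->; apply: ED; rewrite inE.
have m_le : (m <= #|E|)%N.
  have inj : injective (fun p : 'I_m =>
      Input (Dy p) : cell (data n m) 'I_1 (eval_work n)) by move=> p q [].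
  rewrite -{1}[m]card_ord -cardsT -(card_imset _ inj).
  apply/subset_leq_card/fintype.subsetP => c.
  by case/imsetP => p _ ->; apply: ED; rewrite inE.
have E_gt0 : (0 < #|E|)%N.
  apply/card_gt0P; exists (Output ord0).
  by rewrite !finset.in_setU (imset_f (fun o => Output o)) ?orbT.
pose G : {set V} := [set embed_cell c | c in E] :|: [set WZ' ij.1 ij.2 | ij in F]
  :|: [set Output p | p : 'I_m] :|: [set tmp].
have G_le : (#|G| <= 4 * #|E|)%N.
  rewrite (_ : 4 * #|E| = #|E| + #|E| + #|E| + #|E|)%N; last by lia.
  apply: leq_trans (leq_card_setU _ _) _; rewrite leq_add ?cards1 //.
  apply: leq_trans (leq_card_setU _ _) _; apply: leq_add.
    apply: leq_trans (leq_card_setU _ _) _; apply: leq_add; first exact: leq_imset_card.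
    by apply: leq_trans F_le; exact: leq_imset_card.
  by apply: leq_trans (leq_imset_card _ _) _; rewrite card_ord.
apply: leq_trans G_le; apply/subset_leq_card/fintype.subsetP.
have GE c : c \in E -> embed_cell (m := m) c \in G.
  by move=> cE; rewrite !finset.in_setU (imset_f _ cE).
have GD d : d \in D -> Input d \in G by move=> /ED /GE.
have GL i j : (i, j) \in F -> (j <= i)%N -> WL' i j \in G.
  by move=> ij ji; exact: GE (EL i j ij ji).
have GZ i j : (i, j) \in F -> WZ' i j \in G.
  move=> ij; rewrite !finset.in_setU.
  by rewrite (imset_f (fun ij : 'I_n * 'I_n => WZ' ij.1 ij.2) ij) orbT.
have GO p : Output p \in G.
  by rewrite !finset.in_setU (imset_f (fun o => Output o)) ?orbT.
have Gt : tmp \in G by rewrite !finset.in_setU finset.in_set1 eqxx orbT.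
move=> c; case/finset.setUP => [/finset.setUP[]|].
- by case/imsetP => d dD ->; exact: GD.
- by case/imsetP => p _ ->; exact: GO.
rewrite inE /= map_cat flatten_cat cells_map_instr mem_cat => /orP[].
  case/mapP => c' c'E ->; apply: GE; rewrite !finset.in_setU; apply/orP; right.
  by rewrite inE /= catA map_cat flatten_cat mem_cat c'E.
apply/allP: c; rewrite -/(cells _) cells_cat all_cat; apply/andP; split.
  apply: all_cells_loop => k _; set j := rev_ord k.
  have bj i : i \in below P j -> (j <= i)%N /\ (i, j) \in F.
    by rewrite mem_below => /andP[/ltnW].
  rewrite /inverse_column_code !cells_cat allpairs_map_pair !all_cat.
  have jj : (j, j) \in F by exact: fill_diag.
  apply/and5P; split; last apply/andP; last split.
  + apply: all_cells_loop => q /allpairsP[[a b] /= [aj bj' ->]] /=.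
    have [ja Fa] := bj _ aj; have [jb Fb] := bj _ bj'.
    by rewrite Gt !GZ // ?GL // (below_closed symE aj bj').
  + by apply: all_cells_map => i /bj[ji Fi] /=; rewrite GZ ?GL.
  + by apply: all_cells_map => i /bj[ji Fi] /=; rewrite !GZ // fill_sym.
  + by rewrite /cells /= !GZ ?GL.
  + by apply: all_cells_loop => i /bj[ji Fi] /=; rewrite Gt !GZ ?GL.
  + by rewrite /cells /= !GZ ?GL.
rewrite /output_code allpairs_map_pair.
apply: all_cells_loop => q /allpairsPdep[p [[i j] [_ + ->]]]; rewrite mem_enum => ijA /=.
have ijF := patA_chordal ijA.
by rewrite Gt GO GZ // !GD // inE.
Qed.

End Costs.

(** * The Hessian-vector program *)

Section HessProgram.
Context (n m : nat).

(** Along the line through y in direction z only the entries of y vary. *)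
Definition y_tangent (d : data n m) : option 'I_m := if d is Dy p then Some p else None.

Definition hess_program (P : pattern n m) : program (data n m + 'I_m)%type 'I_m :=
  forward_program y_tangent (grad_program P).

Lemma y_tangent_inj (d d' : data n m) p :
  y_tangent d = Some p -> y_tangent d' = Some p -> d = d'.
Proof. by case: d d' => [i j|q i j|i j|i j|q] [] //= q' [->] [->]. Qed.

End HessProgram.

(** * Correctness of the gradient and Hessian-vector programs *)

Section Correctness.
Context (R : realType) (n m : nat) (C : 'M[R]_n) (A : 'I_m -> 'M[R]_n).
Context (S Mt : 'M[R]_n).
Hypothesis symC : symmetric_mx C.
Hypothesis symA : forall p, symmetric_mx (A p).
Local Notation P := (pattern_of C A).
Local Notation D := (data_stored P).
Local Notation D2 := (data2_stored P).
Local Notation h := (hfun C A S Mt).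

Lemma grad_program_gradient (y : 'rV[R]_m) : posdef_mx (slack C A y) ->
  exists s, rexec (init D (data_val C A S Mt y)) (Defs.code (grad_program P)) = Some s /\
    forall p, s (Output p) = partial h p y.
Proof.
move=> /posdef_cholesky[L XL].
have [s [E Hs]] := grad_program_rexec S Mt symC symA XL.
exists s; split=> // p.
by rewrite Hs partial_hfun // (cholesky_factor_det_gt0 XL).
Qed.

(** The gradient program, fixed by the pattern, is run on the curve of data with [t *: z + y] in
    place of y. For small [t] its outputs are the partial derivatives of h, and a derivative at 0
    depends only on values near 0. *)
Lemma hess_program_hessian (y z : 'rV[R]_m) : posdef_mx (slack C A y) ->
  computes (hess_program P) D2 (data2_val C A S Mt y z)
    (fun p => (hessian h y *m z^T) p 0).
Proof.
move=> pdX; have [L XL] := posdef_cholesky pdX.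
have d0 := cholesky_factor_det_gt0 XL.
pose s t : cell (data n m) 'I_m (work (grad_program P)) -> R :=
  init D (data_val C A S Mt (t *: z + y)).
have s0 : s 0 = init D (data_val C A S Mt y) by rewrite /s scale0r add0r.
have [u [Eu _]] := grad_program_gradient pdX.
have ds c : is_derive (0 : R) (1 : R) (s^~ c)
    (init D2 (data2_val C A S Mt y z) (tang_cell (@y_tangent n m) c)).
  have cst_derive d : (forall t, s t d = s 0 d) -> is_derive (0 : R) (1 : R) (s^~ d) 0.
    by move=> sd; rewrite (funext sd); exact: is_derive_cst.
  case: c => [[i j|p i j|i j|i j|p]|o|w]; try exact: cst_derive.
  rewrite /s /= !inE.
  have Hm := is_derive_mul (is_derive_id _ _) (is_derive_cst (z 0 p : R) _ _).
  under eq_fun do rewrite !mxE.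
  apply: (is_derive_eq (is_deriveD Hm (is_derive_cst (y 0 p : R) _ _))).
  by rewrite mul1r mulr0 !addr0.
have prim0 c : init D2 (data2_val C A S Mt y z)
      (@prim_cell _ _ _ (grad_program P) c) = s 0 c.
  by rewrite s0; case: c => [d|o|w] //=; rewrite !inE.
have Eu0 : rexec (s 0) (Defs.code (grad_program P)) = Some u by rewrite s0.
have [u_ [u' [nu Eu' du]]] := forward_programP (@y_tangent_inj n m) ds prim0 Eu0.
exists u'; split=> // p.
rewrite (hessian_mul_hfun S Mt symC symA z p d0).
have pdnear : \forall t \near (0 : R), posdef_mx (slack C A (t *: z + y)).
  have symB : symmetric_mx (- \sum_p z 0 p *: A p).
    rewrite /symmetric_mx linearN linear_sum; congr (- _); apply: eq_bigr => q _.
    by rewrite linearZ /= symA.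
  by apply: filterS (posdef_near pdX symB) => t; rewrite slack_line.
have Hd := is_derive_partial_hfun S Mt symC symA z p d0.
rewrite -(@derive_val _ _ _ _ _ _ _ Hd).
have Hu := du (Output p).
rewrite /= -[LHS](@derive_val _ _ _ _ _ _ _ Hu).
apply: near_eq_derive; near=> t.
have Et : rexec (s t) (Defs.code (grad_program P)) = Some (u_ t) by near: t.
have pdt : posdef_mx (slack C A (t *: z + y)) by near: t.
(* Execution is deterministic, so the state [u_ t] is the one that holds the gradient at the nearby
   point. *)
have [v [Ev Hv]] := grad_program_gradient pdt.
by move: Ev; rewrite -/(s t) Et => -[->].
Unshelve. all: by end_near.
Qed.

End Correctness.

Theorem mainTheorem4 :
  exists (K : nat)
    (grad_program : forall n m : nat, pattern n m -> program (data n m) 'I_m)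
    (hess_program : forall n m : nat,
        pattern n m -> program (data n m + 'I_m)%type 'I_m),
  forall (R : realType) (n m : nat) (C : 'M[R]_n) (A : 'I_m -> 'M[R]_n)
    (S Mt : 'M[R]_n) (y : 'rV[R]_m),
  symmetric_mx C -> (forall p, symmetric_mx (A p)) ->
  symmetric_mx S -> symmetric_mx Mt ->
  let P := pattern_of C A in
  mx_support S \subset chordal P ->
  posdef_mx (slack C A y) ->
  let h := hfun C A S Mt in
  let x := data_val C A S Mt y in
  let D := data_stored P in
  let D2 := data2_stored P in
  [/\ computes (eval_program P) D x (fun _ => h y),
      twice_derivable h y,
      [/\ computes (grad_program n m P) D x (fun p => gradient h y p 0),
          (time_cost (grad_program n m P) <= K * time_cost (eval_program P))%N
        & (space_cost (grad_program n m P) D <= K * space_cost (eval_program P) D)%N]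
    & [/\ forall z : 'rV[R]_m,
            computes (hess_program n m P) D2 (data2_val C A S Mt y z)
              (fun p => (hessian h y *m z^T) p 0),
          (time_cost (hess_program n m P) <= K * time_cost (eval_program P))%N
        & (space_cost (hess_program n m P) D2 <= K * space_cost (eval_program P) D)%N]].
Proof.
(* Time: the factor 4 of the gradient program times the factor 4 of forward mode. Space:
   [2 * (4 * e) + 2 <= 16 * e] for the evaluation space [e], which is positive because the output
   cell is counted. *)
exists 16%N, grad_program, hess_program => R n m C A S Mt y symC symA _ _ P SF pdX h x D D2.
have [L XL] := posdef_cholesky pdX.
have d0 := cholesky_factor_det_gt0 XL.
have tg : (time_cost (grad_program P) <= 4 * time_cost (eval_program P))%N.
  exact: time_grad_program.
have sg : (space_cost (grad_program P) D <= 4 * space_cost (eval_program P) D)%N.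
  exact: space_grad_program (aggregate_sym symC symA).
have e0 : (0 < space_cost (eval_program P) D)%N.
  apply/card_gt0P; exists (Output ord0).
  by rewrite !finset.in_setU (imset_f (fun o => Output o)) ?orbT.
split.
- exact: (eval_programP Mt symC symA XL SF).
- exact: twice_derivable_hfun.
- split.
  + have [s [E Hs]] := grad_program_gradient S Mt symC symA pdX.
    exists s; split; first exact: rexec_exec.
    by move=> p; rewrite Hs mxE.
  + by apply: leq_trans tg _; rewrite leq_mul2r orbT.
  + by apply: leq_trans sg _; rewrite leq_mul2r orbT.
- split.
  + by move=> z; exact: hess_program_hessian.
  + apply: leq_trans (time_forward_program _ _) _.
    by rewrite (_ : 16 = 4 * 4)%N // -mulnA leq_mul2l.
  + apply: (@leq_trans (2 * space_cost (grad_program P) D + 2)).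
      apply: space_forward_program => [d|p _]; first by rewrite inE.
      by exists (Dy p); rewrite ?inE.
    by clear -sg e0; lia.
Qed.
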